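(* Let $X,Y$ be Banach spaces, let $y=\mathcal{G}(u)+\eta$ with $\mathcal{G}:X\to Y$, where $\eta$ is a $Y$-valued random variable with law $\mathbb{Q}_0$, and let $\mathbb{Q}^u$ be the law of $y$ given $u$. Suppose $\mathbb{Q}^u$ is absolutely continuous with respect to $\mathbb{Q}_0$ and let $\Phi:X\times Y\to\mathbb{R}$ be such that $\frac{d\mathbb{Q}^u}{d\mathbb{Q}_0}(y)=\exp(-\Phi(u;y))$ and $\int_Y\exp(-\Phi(u;y))\,\mathbb{Q}_0(dy)=1$. Assume: (i) there is $\alpha_1>0$ and for every $r>0$ an $M\in\mathbb{R}$ such that $\Phi(u;y)\ge M-\alpha_1\|u\|_X$ for all $u\in X$ and all $y\in Y$ with $\|y\|_Y<r$; (ii) for every $r>0$ there is $K=K(r)>0$ such that $\Phi(u;y)\le K$ for all $u\in X$, $y\in Y$ with $\max\{\|u\|_X,\|y\|_Y\}<r$; (iii) for every $r>0$ there is $L=L(r)>0$ such that $|\Phi(u_1;y)-\Phi(u_2;y)|\le L\|u_1-u_2\|_X$ for all $u_1,u_2\in X$, $y\in Y$ with $\max\{\|u_1\|_X,\|u_2\|_X,\|y\|_Y\}<r$; (iv) there is $\alpha_2>0$ and for every $r>0$ a $C'\in\mathbb{R}$ such that $|\Phi(u;y_1)-\Phi(u;y_2)|\le\exp(\alpha_2\|u\|_X+C')\|y_1-y_2\|_Y$ for all $y_1,y_2\in Y$ with $\max\{\|y_1\|_Y,\|y_2\|_Y\}<r$ and every $u\in X$. Suppose that for some $t<\infty$ the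 space $C^t=C^t(\mathbb{T}^d)$ is continuously embedded in $X$, with embedding constant $c_e$: $\|u\|_X\le c_e\|u\|_{C^t}$. Let $1\le q<\infty$, $s>t+\frac dq$, and $\kappa^*=2\,c_e\,r^*(\alpha_1+2\alpha_2)$, with $r^*=r^*(s,t,d,q)$ the constant defined in the context. If $\mu_0$ is a $(\kappa,X^{s,q})$ measure with $\kappa>\kappa^*$, then for every $r>0$ there is a constant $C=C(r)$ such that the posterior measures satisfy $$d_{\mathrm{Hell}}(\mu^y,\mu^{y'})\le C\,\|y-y'\|_Y$$ for all $y,y'\in Y$ with $\max\{\|y\|_Y,\|y'\|_Y\}\le r$.
   Context: $\mathbb{T}^d=(0,1]^d$ is the $d$-dimensional torus, $d\le3$. Wavelet basis: $\{\psi_l\}_{l\ge1}$ is a $\varrho$-regular orthonormal wavelet basis of $L^2(\mathbb{T}^d)$ with $\varrho>s$, i.e. the periodification of a wavelet basis of $L^2(\mathbb{R}^d)$ whose scaling function and mother wavelets $\bar\psi_m$ ($m=1,\dots,2^d-1$) are $\varrho$-regular; a function $f$ is $\varrho$-regular if $f\in C^\varrho$ and for every integer $m\in\mathbb{N}$ there is $C_m$ with $|\partial^\alpha f(x)|\le C_m(1+|x|)^{-m}$ for all multi-indices $|\alpha|\le\varrho$. The basis is ordered by increasing scale: $\psi_1$ is the (periodized) scaling function and, for $j\ge0$, the $\psi_l$ with $2^{jd}<l\le2^{(j+1)d}$ enumerate the scale-$j$ functions $2^{jd/2}\sum_{n\in\mathbb{Z}^d}\bar\psi_m(2^j(x-n)-k)$,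 $1\le m\le 2^d-1$, $k\in\{0,\dots,2^j-1\}^d$. Prior: a $(\kappa,X^{s,q})$ measure ($\kappa>0$) is the law of the random function $u=\sum_{l=1}^\infty l^{-(\frac sd+\frac12-\frac1q)}(\frac1\kappa)^{\frac1q}\xi_l\psi_l$, where $\{\xi_l\}$ are real-valued i.i.d. with density proportional to $\exp(-\frac12|x|^q)$. (Here $\|f\|_{X^{s,q}}=(\sum_l l^{sq/d+q/2-1}|f_l|^q)^{1/q}$ for $f=\sum_l f_l\psi_l$.) Norm: $C^t$ is the Hölder space, identified with $B^t_{\infty,\infty}(\mathbb{T}^d)$, with norm $\|f\|_{C^t}=\sup_{l} l^{\frac td+\frac12}|f_l|$ for $f=\sum_l f_l\psi_l$. Posterior: the joint law of $(u,y)$ is $\pi(du,dy)=\mu_0(du)\,\mathbb{Q}^u(dy)$, and $\mu^y$ is the conditional distribution of $u$ given $y$; it has density $\frac{d\mu^y}{d\mu_0}(u)=\frac1{Z(y)}\exp(-\Phi(u;y))$ with $Z(y)=\int_X\exp(-\Phi(u;y))\,\mu_0(du)$. Hellinger metric: $d_{\mathrm{Hell}}(\mu,\mu')=\sqrt{\frac12\int\left(\sqrt{\frac{d\mu}{d\nu}}-\sqrt{\frac{d\mu'}{d\nu}}\right)^2d\nu}$ for any reference measure $\nu$ with respect to which $\mu,\mu'$ are absolutely continuous. Constant $r^*$: let $c_d=2\pi^{d/2}/\Gamma(d/2)$, $c_0=\int_{\mathbb{R}^d}\exp(-\frac12|x|^q)\,dx$, $c_{01}=c_d^{-1}\int_{\mathbb{R}^d}e^{-|x|/2}\,dx$.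 Let $r_1=r_1(s,t,d,q)>0$ be a number such that $$\int_{r_1}^\infty x^{(d-k)(\frac{s-t}{d}-\frac1q)}\exp\left(-\tfrac12x^{\frac{s-t}{d}-\frac1q}\right)dx<\frac{c_{01}}{4(d+1)}\,\frac{1}{2^{k+1}\binom dk},\qquad k=0,\dots,d,$$ and let $c_{q,d}=(2^d q\,c_0/c_d)^{1/(d-q+1)}$ if $1\le q<1+\frac34$, and $c_{q,d}=\max\{1,2^{d+2}q\,c_0/c_d\}$ if $q\ge1+\frac34$. Then $r^*=(\ln2)\max\{r_1,c_{q,d}\}$. *)

(* Defs.v *)
From HB Require Import structures.
From mathcomp Require Import all_boot all_order all_algebra.
From mathcomp Require Import all_classical all_reals all_analysis.
From mathcomp Require Import measurable_realfun.
Set Implicit Arguments.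
Unset Strict Implicit.
Unset Printing Implicit Defensive.
Import Order.TTheory GRing.Theory Num.Theory.
Import numFieldNormedType.Exports.
Local Open Scope classical_set_scope.
Local Open Scope ring_scope.

Local Open Scope charge_scope.

Notation borel T := (g_sigma_algebraType (@open T)).

(* Lebesgue measure on R^n, by iterated products; lebesgue_tuple_box identifies
   it through its values on boxes. *)
Section lebesgue_tuple.
Context {R : realType}.
Local Notation RR := (measurableTypeR R).

Definition cons_pair n (x : RR * n.-tuple RR) : n.+1.-tuple RR :=
  [tuple of x.1 :: x.2].

Lemma thead_cons_pair n (z : RR * n.-tuple RR) : thead (cons_pair z) = z.1.
Proof. exact: theadE. Qed.

Lemma behead_cons_pair n (z : RR * n.-tuple RR) :
  [tuple of behead (cons_pair z)] = z.2.
Proof. exact/val_inj. Qed.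

Lemma measurable_cons_pair n : measurable_fun setT (@cons_pair n).
Proof. exact: measurable_cons. Qed.

Section step.
Local Open Scope ereal_scope.
Variables (n : nat) (mu : {sigma_finite_measure set (n.-tuple RR) -> \bar R}).

Definition lebesgue_cons : set (n.+1.-tuple RR) -> \bar R :=
  pushforward (lebesgue_measure \x mu) (@cons_pair n).

Let lebesgue_cons0 : lebesgue_cons set0 = 0.
Proof. by rewrite /lebesgue_cons /pushforward preimage_set0 measure0. Qed.

Let lebesgue_cons_ge0 A : 0 <= lebesgue_cons A.
Proof. by rewrite /lebesgue_cons /pushforward measure_ge0. Qed.

Let lebesgue_cons_sigma_additive : semi_sigma_additive lebesgue_cons.
Proof.
apply: (@measure_semi_sigma_additive _ _ _ (pushforward _ _)).
exact: measurable_cons_pair.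
Qed.

HB.instance Definition _ := isMeasure.Build _ _ _ lebesgue_cons
  lebesgue_cons0 lebesgue_cons_ge0 lebesgue_cons_sigma_additive.

Lemma lebesgue_consE (A : set RR) (B : set (n.-tuple RR)) :
  measurable A -> measurable B ->
  lebesgue_cons [set x | A (thead x) /\ B [tuple of behead x]] =
    lebesgue_measure A * mu B.
Proof.
move=> mA mB; rewrite -product_measure1E// /lebesgue_cons /pushforward.
by congr (_ _); apply/seteqP; split => z /=;
  rewrite thead_cons_pair behead_cons_pair.
Qed.

Let lebesgue_cons_sigma_finite : sigma_finite setT lebesgue_cons.
Proof.
have /sigma_finiteP[F [TF ndF Foo]] := sigma_finiteT (@lebesgue_measure R).
have /sigma_finiteP[G [TG ndG Goo]] := sigma_finiteT mu.
exists (fun k => [set x | F k (thead x) /\ G k [tuple of behead x]]).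
  apply/seteqP; split=> x _ //.
  have [i _ Fi] : (\bigcup_i F i) (thead x) by rewrite -TF.
  have [j _ Gj] : (\bigcup_i G i) [tuple of behead x] by rewrite -TG.
  exists (maxn i j) => //; split.
    by move: Fi; exact/subsetPset/ndF/leq_maxl.
  by move: Gj; exact/subsetPset/ndG/leq_maxr.
move=> k; have [mF Fk] := Foo k; have [mG Gk] := Goo k; split.
  apply: measurableI.
    by rewrite -[X in measurable X]setTI; exact: measurable_tnth.
  by rewrite -[X in measurable X]setTI; exact: measurable_behead.
by rewrite lebesgue_consE// lte_mul_pinfty// ge0_fin_numE.
Qed.

HB.instance Definition _ := Measure_isSigmaFinite.Build _ _ _ lebesgue_cons
  lebesgue_cons_sigma_finite.

End step.

Fixpoint lebesgue_tuple n : {sigma_finite_measure set (n.-tuple RR) -> \bar R} :=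
  match n with
  | 0 => \d_([tuple])
  | m.+1 => lebesgue_cons (lebesgue_tuple m)
  end.

Lemma lebesgue_tuple_box n (A : 'I_n -> set RR) :
  (forall i, measurable (A i)) ->
  (lebesgue_tuple n [set x | forall i, A i (tnth x i)] =
    \prod_(i < n) lebesgue_measure (A i))%E.
Proof.
elim: n A => [|n IHn] A mA /=.
  by rewrite big_ord0 diracE mem_set// => -[].
rewrite big_ord_recl -IHn// -lebesgue_consE//; last first.
  rewrite (_ : mkset _ = \bigcap_i ((@tnth _ RR ^~ i) @^-1` A (lift ord0 i))); last first.
    by apply/seteqP; split => x /= h i; [move=> _|]; exact: h.
  apply: fin_bigcap_measurable => // i _.
  by rewrite -[X in measurable X]setTI; exact: measurable_tnth.
have tnthb (x : n.+1.-tuple RR) j :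
    tnth x (lift ord0 j) = tnth [tuple of behead x] j.
  by rewrite {1}(tuple_eta x) tnthS.
congr (lebesgue_cons _ _); apply/seteqP; split => x /=.
  by move=> h; split=> [|i]; [exact: h|rewrite -tnthb; exact: h].
move=> [h0 h1] i; case: (unliftP ord0 i) => [j ->|->//].
by rewrite tnthb; exact: h1.
Qed.
End lebesgue_tuple.

Section euclidean_space.
Context {R : realType} {d : nat}.
Local Notation RR := (measurableTypeR R).
Implicit Types (f g : 'rV[R]_d -> R) (D : set 'rV[R]_d) (k : 'rV[int]_d).

(* Functions on R^d take row vectors, on which directional derivatives are
   available; they are integrated through the bijection with tuples. *)
Definition vec (x : d.-tuple RR) : 'rV[R]_d := \row_i tnth x i.

Definition eint D (f : 'rV[R]_d -> \bar R) : \bar R :=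
  (\int[@lebesgue_tuple R d]_(x in vec @^-1` D) f (vec x))%E.

Definition rint D f : R := fine (eint D (fun x => (f x)%:E)).

Definition euclidean_norm (x : 'rV[R]_d) : R :=
  Num.sqrt (\sum_i x ord0 i ^+ 2).

Definition lattice_vec k : 'rV[R]_d := map_mx intr k.

(* The iterated partial derivative along the coordinates listed in a; for
   functions of class C^k the order is irrelevant, so that sequences of length
   at most k stand for the multi-indices of order at most k. *)
Definition pderiv f (a : seq 'I_d) : 'rV[R]_d -> R :=
  foldr (fun i g x => 'D_(delta_mx ord0 i) g x) f a.

Definition classC (k : nat) f : Prop :=
  (forall a : seq 'I_d, (size a <= k)%N -> continuous (pderiv f a)) /\
  (forall (a : seq 'I_d) (i : 'I_d) (x : 'rV[R]_d), (size a < k)%N ->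
     derivable (pderiv f a) x (delta_mx ord0 i)).

Definition regular (rho : nat) f : Prop :=
  classC rho f /\
  forall m : nat, exists C : R, forall (a : seq 'I_d) (x : 'rV[R]_d),
    (size a <= rho)%N ->
    `|pderiv f a x| <= C * (1 + euclidean_norm x) ^- m.

Definition inner_product D f g : R := rint D (fun x => f x * g x).

Definition square_integrable D f : Prop :=
  measurable_fun (vec @^-1` D) (f \o vec) /\
  (eint D (fun x => (f x ^+ 2)%:E) < +oo)%E.

Definition orthonormal_basis D (I : eqType) (e : I -> 'rV[R]_d -> R) : Prop :=
  [/\ forall i, square_integrable D (e i),
      forall i j, inner_product D (e i) (e j) = (i == j)%:R
    & forall f, square_integrable D f ->
        (forall i, inner_product D f (e i) = 0) ->
        {ae @lebesgue_tuple R d, forall x, D (vec x) -> f (vec x) = 0}].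

Definition torus : set 'rV[R]_d := [set x | forall i, 0 < x ord0 i <= 1].

(* Unordered sum over Z^d of an absolutely summable family of reals. *)
Definition lattice_sum (a : 'rV[int]_d -> R) : R :=
  fine (\esum_(n in [set: 'rV[int]_d]) (Num.max (a n) 0)%:E) -
  fine (\esum_(n in [set: 'rV[int]_d]) (Num.max (- a n) 0)%:E).

Definition periodize f (x : 'rV[R]_d) : R :=
  lattice_sum (fun n => f (x - lattice_vec n)).

Definition dilate f (j : nat) k (x : 'rV[R]_d) : R :=
  2 `^ ((j * d)%:R / 2) * f (2 ^+ j *: x - lattice_vec k).

Definition wavelet_system (phi : 'rV[R]_d -> R)
    (mother : 'I_(2 ^ d).-1 -> 'rV[R]_d -> R)
    (i : 'rV[int]_d + nat * 'I_(2 ^ d).-1 * 'rV[int]_d) : 'rV[R]_d -> R :=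
  match i with
  | inl k => fun x => phi (x - lattice_vec k)
  | inr (j, m, k) => dilate (mother m) j k
  end.

(* Sequences indexed by l >= 1 on paper are indexed from 0 here: psi l is the
   function psi_(l+1), so that 2^(jd) < l <= 2^((j+1)d) is shifted by one. *)
Definition wavelet_basis (rho : nat) (psi : nat -> 'rV[R]_d -> R) : Prop :=
  orthonormal_basis torus psi /\
  exists (phi : 'rV[R]_d -> R) (mother : 'I_(2 ^ d).-1 -> 'rV[R]_d -> R),
  [/\ regular rho phi /\ (forall m, regular rho (mother m)),
      orthonormal_basis setT (wavelet_system phi mother),
      forall x, psi 0%N x = periodize phi x
    & forall j : nat,
      exists e : 'I_(2 ^ d).-1 * {ffun 'I_d -> 'I_(2 ^ j)} -> nat,
        set_bij setT [set l | (2 ^ (j * d) <= l < 2 ^ (j.+1 * d))%N] e /\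
        forall m (k : {ffun 'I_d -> 'I_(2 ^ j)}) x,
          psi (e (m, k)) x =
          periodize (dilate (mother m) j (\row_i (k i : nat)%:Z)) x].

(* A distribution on the torus is an element of test_function -> R; linearity
   and continuity are not imposed here but follow, for the elements of
   holder_space below, from the existence of a wavelet expansion. *)
Definition test_function : Type :=
  {f : 'rV[R]_d -> R |
    (forall n, classC n f) /\ (forall x n, f (x + lattice_vec n) = f x)}.

Definition distr_of (f : 'rV[R]_d -> R) : test_function -> R :=
  fun h => inner_product torus f (sval h).

(* T = \sum_l a_l psi_l in the sense of distributions. *)
Definition wavelet_expansion (psi : nat -> 'rV[R]_d -> R) (a : nat -> R)
    (T : test_function -> R) : Prop :=
  forall h : test_function,
    (fun N => \sum_(0 <= l < N) a l * distr_of (psi l) h) @ \oo --> T h.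

(* sup_l l^(t/d+1/2) |a_l|, and +oo for a distribution outside of C^t. For
   t > - rho, the range in which these are the Besov norms, the coefficients of
   an element of C^t are unique and the infimum has at most one finite term. *)
Definition holder_norm (psi : nat -> 'rV[R]_d -> R) (t : R)
    (T : test_function -> R) : \bar R :=
  ereal_inf [set z | exists2 a, wavelet_expansion psi a T &
    z = ereal_sup (range (fun l : nat =>
          (l.+1%:R `^ (t / d%:R + 2^-1) * `|a l|)%:E))].

Definition holder_space psi t : set (test_function -> R) :=
  [set T | (holder_norm psi t T < +oo)%E].

(* Only the values of iota on C^t are relevant. *)
Definition holder_embedding (X : normedModType R) psi (t : R)
    (iota : (test_function -> R) -> X) (ce : R) : Prop :=
  [/\ forall (c : R) T1 T2, holder_space psi t T1 -> holder_space psi t T2 ->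
        iota (fun h => c * T1 h + T2 h) = c *: iota T1 + iota T2,
      forall T1 T2, holder_space psi t T1 -> holder_space psi t T2 ->
        iota T1 = iota T2 -> T1 = T2
    & forall T, holder_space psi t T ->
        (`|iota T|%:E <= ce%:E * holder_norm psi t T)%E].

End euclidean_space.

Section prior.
Context {R : realType}.

Definition mutually_independent dO (Omega : measurableType dO)
    (P : probability Omega R) (xi : nat -> {RV P >-> measurableTypeR R}) : Prop :=
  forall (J : seq nat) (B : nat -> set (measurableTypeR R)), uniq J ->
    (forall l, measurable (B l)) ->
    (P (\bigcap_(l in [set` J]) (xi l @^-1` B l)) =
       \prod_(l <- J) P (xi l @^-1` B l))%E.

Definition besov_density (q x : R) : R :=
  expR (- (2^-1 * `|x| `^ q)) /
  \int[@lebesgue_measure R]_z expR (- (2^-1 * `|z| `^ q)).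

(* mu0 is a (kappa, X^{s,q}) measure, carried by a space X in which C^t is
   embedded by iota: the random series is summed in X, almost surely. *)
Definition besov_measure (d : nat) (psi : nat -> 'rV[R]_d -> R)
    (X : normedModType R) (iota : (@test_function R d -> R) -> X)
    (kappa s q : R) (mu0 : probability (borel X) R) : Prop :=
  exists (dO : measure_display) (Omega : measurableType dO)
    (P : probability Omega R) (xi : nat -> {RV P >-> measurableTypeR R})
    (u : {RV P >-> borel X}),
  [/\ mutually_independent xi,
      forall l (A : set (measurableTypeR R)), measurable A ->
        (distribution P (xi l) A =
           \int[lebesgue_measure]_(x in A) (besov_density q x)%:E)%E,
      {ae P, forall w, (fun N => \sum_(0 <= l < N)
         (l.+1%:R `^ (- (s / d%:R + 2^-1 - q^-1)) * kappa^-1 `^ q^-1 * xi l w)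
           *: iota (distr_of (psi l))) @ \oo --> (u w : X)}
    & forall A, measurable A -> mu0 A = distribution P u A].

End prior.

Section bayes.
Context {R : realType} {dX dY : measure_display}
  {X : measurableType dX} {Y : measurableType dY}.

Definition joint_law (mu0 : probability X R) (Q : X -> probability Y R)
    (p : probability (X * Y)%type R) : Prop :=
  forall A B, measurable A -> measurable B ->
    (p (A `*` B) = \int[mu0]_(u in A) Q u B)%E.

HB.instance Definition _ :=
  isMeasurableFun.Build _ _ (X * Y)%type Y snd measurable_snd.

Definition conditional_law (p : probability (X * Y)%type R)
    (post : Y -> probability X R) : Prop :=
  (forall A, measurable A -> measurable_fun setT (fun y => post y A)) /\
  forall A B, measurable A -> measurable B ->
    (p (A `*` B) = \int[distribution p snd]_(y in B) post y A)%E.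

Definition has_density d (T : measurableType d) (mu nu : probability T R)
    (f : T -> R) : Prop :=
  mu `<< nu /\
  ae_eq nu setT ('d (charge_of_finite_measure mu) '/d nu) (EFin \o f).

(* The conditional law only determines post y for almost every y; the density
   selects the version that is defined for every y. *)
Definition posterior (mu0 : probability X R) (Q : X -> probability Y R)
    (Phi : X -> Y -> R) (post : Y -> probability X R) : Prop :=
  (exists2 p, joint_law mu0 Q p & conditional_law p post) /\
  forall y, has_density (post y) mu0
    (fun u => expR (- Phi u y) / \int[mu0]_v expR (- Phi v y)).

(* The Hellinger distance computed with the reference measure nu. *)
Definition hellinger d (T : measurableType d)
    (nu : {sigma_finite_measure set T -> \bar R}) (mu mu' : probability T R) : R :=
  Num.sqrt (2^-1 * \int[nu]_x
    (Num.sqrt (fine (('d (charge_of_finite_measure mu) '/d nu) x)) -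
     Num.sqrt (fine (('d (charge_of_finite_measure mu') '/d nu) x))) ^+ 2).

End bayes.

Section constants.
Context {R : realType} (d : nat).
Implicit Types s t q r : R.

Definition Gamma (a : R) : R :=
  \int[@lebesgue_measure R]_(x in `]0, +oo[) (x `^ (a - 1) * expR (- x)).

Definition cst_d : R := 2 * pi `^ (d%:R / 2) / Gamma (d%:R / 2).

Definition cst_0 q : R :=
  rint setT (fun x : 'rV[R]_d => expR (- (2^-1 * euclidean_norm x `^ q))).

Definition cst_01 : R :=
  cst_d^-1 * rint setT (fun x : 'rV[R]_d => expR (- (euclidean_norm x / 2))).

Definition admissible_r1 s t q (r1 : R) : Prop :=
  0 < r1 /\
  forall k : nat, (k <= d)%N ->
    (\int[@lebesgue_measure R]_(x in `]r1, +oo[)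
       (x `^ ((d - k)%:R * ((s - t) / d%:R - q^-1)) *
        expR (- (2^-1 * x `^ ((s - t) / d%:R - q^-1))))%:E <
     (cst_01 / (4 * d.+1%:R) * (1 / (2 ^+ k.+1 * 'C(d, k)%:R)))%:E)%E.

Definition cst_q q : R :=
  if q < 1 + 3 / 4 then
    (2 ^+ d * q * cst_0 q / cst_d) `^ (1 / (d%:R - q + 1))
  else Num.max 1 (2 ^+ d.+2 * q * cst_0 q / cst_d).

Definition r_star q (r1 : R) : R := ln 2 * Num.max r1 (cst_q q).

End constants.

(* Main.v *)
(* Only an exponential moment of mu0 is needed.  Expanding u in wavelets, the
   embedding gives |u|_X <= ce kappa^(-1/q) sup_l l^(-gamma) |xi_l| with
   gamma = (s - t)/d - 1/q > 0.  For 0 < a < b, splitting on |xi_l| <= l^gamma,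
     exp (a l^(-gamma) |xi_l|) <= e^a + exp (b |xi_l|) exp (- (b - a) l^gamma),
   and the right-hand sides sum over l to an integrable function as soon as
   exp (b |xi_1|) is integrable; independence plays no role.  For q > 1 this
   holds for every b, for q = 1 it asks b < 1/2, and r^* >= 1 then turns the
   condition on kappa into a < 1/2 for a = (alpha1 + 2 alpha2) ce / kappa.  Here
   r^* >= 1 because ln 2 >= 1/2 and c_{1,d} >= 2, the latter from |x| <= |x|_1
   in c_0, which gives c_0 >= 4^d >= c_d.

   The densities of the posteriors are squares of g / |g|, g' / |g'| with
   g = exp (- Phi (.; y) / 2) and L^2(mu0) norms, and
     | g / |g| - g' / |g'| |^2 <= |g - g'|^2 / (|g| |g'|),
   so that the normalizing constants need not be compared; finally |g - g'|^2
   is at most |y - y'|^2 times the integral of exp ((alpha1 + 2 alpha2) |u|). *)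
Require Import Defs.
From HB Require Import structures.
From mathcomp Require Import all_boot all_order all_algebra.
From mathcomp Require Import all_classical all_reals all_analysis.
From mathcomp Require Import measurable_realfun.
From mathcomp Require Import ring lra.
Import Order.TTheory GRing.Theory Num.Theory.
Import numFieldNormedType.Exports.
Local Open Scope classical_set_scope.
Local Open Scope ring_scope.

(** * Gamma at half-integers *)

Lemma integral_expR_itv (R : realType) (c a : R) : 0 < c ->
  (\int[@lebesgue_measure R]_(x in `[a, +oo[) (expR (- (c * x)))%:E =
   (c^-1 * expR (- (c * a)))%:E)%E.
Proof.
move=> c0.
have cE : continuous (fun x : R => expR (- (c * x))).
  move=> x; apply: continuous_comp; last exact: continuous_expR.
  by apply: cvgN; apply: cvgM; [exact: cvg_cst|exact: cvg_id].
have dF (x : R) : is_derive x 1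
    (fun x : R => - (c^-1 * expR (- (c * x)))) (expR (- (c * x))).
  apply: is_derive_eq.
  rewrite /GRing.scale /= mulr1 !mulrN opprK mulrCA mulVf ?mulr1 //.
  by rewrite gt_eqF.
rewrite (@ge0_continuous_FTC2y _ _ (fun x => - (c^-1 * expR (- (c * x)))) _ 0).
- by rewrite -EFinB sub0r opprK.
- by move=> x _; exact: expR_ge0.
- exact: continuous_subspaceT.
- rewrite -oppr0 -[X in - X](mulr0 c^-1); apply: cvgN; apply: cvgM; first exact: cvg_cst.
  apply: (@cvg_comp _ _ _ (fun x => c * x) (fun x : R => expR (- x)) _ (pinfty_nbhs R)).
    exact: gt0_cvgMry.
  exact: cvgr_expR.
- by move=> x _; apply: ex_derive.
- apply: cvg_at_right_filter; apply: cvgN; apply: cvgM; first exact: cvg_cst.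
  exact: cE.
- by move=> x _; rewrite derive1E derive_val.
Qed.

Lemma integral_expR_norm (R : realType) (c : R) : 0 < c ->
  (\int[@lebesgue_measure R]_x (expR (- (c * `|x|)))%:E = (2 / c)%:E)%E.
Proof.
move=> c0; rewrite ge0_symfun_integralT.
- rewrite -set_itvcy; under eq_integral => x.
    rewrite inE /= in_itv/= andbT => x0; rewrite ger0_norm //; over.
  by rewrite integral_expR_itv// mulr0 oppr0 expR0 mulr1 -EFinM.
- by move=> x; exact: expR_ge0.
- move=> x; apply: continuous_comp; last exact: continuous_expR.
  apply: cvgN; apply: cvgM; [exact: cvg_cst|exact: norm_continuous].
- by move=> x /=; rewrite normrN.
Qed.

(* The substitution x = y^2 is singular at 0; whence the lower bound a > 0. *)
Lemma integral_gauss_powR (R : realType) (a : R) : 0 < a ->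
  (\int[@lebesgue_measure R]_(x in `[a, +oo[) (x `^ (2^-1 - 1) * expR (- x))%:E =
   2%:E * \int[@lebesgue_measure R]_(x in `[(a `^ 2^-1)%R, +oo[) (gauss_fun x)%:E)%E.
Proof.
move=> a0.
have cP (r x : R) : 0 < x -> {for x, continuous (@powR R ^~ r)}.
  move=> x0; apply: differentiable_continuous; apply/derivable1_diffP.
  by apply: derivable_powR; rewrite in_itv/= x0.
have cM (x : R) : 0 < x -> 2^-1 * y `^ (2^-1 - 1) @[y --> x] --> 2^-1 * x `^ (2^-1 - 1).
  by move=> x0; apply: cvgM; [exact: cvg_cst|exact: cP].
have cvgP : (fun x : R => x `^ 2^-1) @ +oo --> +oo.
  apply/cvgryPge => A; near=> x.
  have x0 : 0 < x by near: x; exact: nbhs_pinfty_gt.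
  rewrite powR12_sqrt; last exact: ltW.
  have A1 : 0 <= `|A| + 1 by rewrite addr_ge0.
  apply: (@le_trans _ _ (`|A| + 1)); first by rewrite ler_wpDr// ler_norm.
  rewrite -(ger0_norm A1) -sqrtr_sqr ler_sqrt ?(ltW x0)//.
have DF : {in `]0, +oo[%R, (@powR R ^~ 2^-1) ^`()%classic =1
    (fun x => 2^-1 * x `^ (2^-1 - 1))} := powR_derive1 _.
have DFa (x : R) : x \in `]a, +oo[%R -> x \in `]0, +oo[%R.
  by rewrite !in_itv/= !andbT; exact: lt_trans.
(* The Gaussian integral is rewritten by [y = x^(1/2)], whose derivative [2^-1 * x^(-1/2)] supplies
   the factor 2 of the statement. The later goals are monotonicity of the root and continuity and
   limits of its derivative, which tends to 0 at infinity. *)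
rewrite (@increasing_ge0_integration_by_substitutiony _ (fun x => x `^ 2^-1) (@gauss_fun R) a).
- rewrite [X in (2 * X)%E](_ : _ =
      (\int[@lebesgue_measure R]_(x in `[a, +oo[)
         (2^-1%:E * (x `^ (2^-1 - 1) * expR (- x))%:E))%E); last first.
    apply: eq_integral => x; rewrite inE/= in_itv/= andbT => ax.
    have x0 := lt_le_trans a0 ax.
    rewrite -EFinM; congr EFin.
    transitivity (gauss_fun (x `^ 2^-1) * ((@powR R ^~ 2^-1) ^`()%classic x)) => //.
    rewrite DF ?in_itv/= ?x0// /gauss_fun powR12_sqrt ?ltW// sqr_sqrtr ?ltW//.
    by rewrite mulrCA [expR _ * _]mulrC.
  rewrite ge0_integralZl//.
  + by rewrite muleA -EFinM divff// mul1e.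
  + apply/measurable_EFinP/measurable_funM.
      by apply: measurable_funTS.
    apply: measurable_funTS; apply: measurableT_comp => //; exact: measurableT_comp.
  + by move=> x _; rewrite lee_fin mulr_ge0// ?powR_ge0 ?expR_ge0.
- move=> x y; rewrite !in_itv/= !andbT => ax ay xy.
  by apply: gt0_ltr_powR; rewrite ?nnegrE ?(le_trans (ltW a0)).
- move=> x /DFa x0; have x0' : 0 < x by move: x0; rewrite in_itv/= andbT.
  apply: (@cvg_trans _ ((2^-1 * y `^ (2^-1 - 1)) @[y --> x])).
    apply: near_eq_cvg; near=> y; rewrite /= DF// in_itv/= andbT.
    by near: y; exact: lt_nbhsr.
  by rewrite DF//; exact: cM.
- apply/cvg_ex; exists (2^-1 * a `^ (2^-1 - 1)).
  apply: cvg_at_right_filter.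
  apply: (@cvg_trans _ ((2^-1 * y `^ (2^-1 - 1)) @[y --> a])).
    apply: near_eq_cvg; near=> y; rewrite /= DF// in_itv/= andbT.
    by near: y; exact: lt_nbhsr.
  exact: cM.
- apply/cvg_ex; exists (2^-1 * 0).
  apply: (@cvg_trans _ ((2^-1 * (y `^ 2^-1)^-1) @[y --> +oo])).
    apply: near_eq_cvg; near=> y.
    have y0 : 0 < y by near: y; exact: nbhs_pinfty_gt.
    rewrite /= DF ?in_itv/= ?y0// -powRN; congr (_ * _ `^ _).
    by lra.
  apply: cvgM; first exact: cvg_cst.
  apply/gtr0_cvgV0 => //; near=> y; apply: powR_gt0.
  by near: y; exact: nbhs_pinfty_gt.
- split; first by move=> x /DFa x0; exact: derivable_powR.
  by apply: cvg_at_right_filter; exact: cP.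
- exact: cvgP.
- apply: continuous_subspaceT; exact: continuous_gauss_fun.
- by move=> x _; exact: gauss_fun_ge0.
Unshelve. all: by end_near. Qed.

(** Exhausting the open half-line from the right of 0 lets identities proved away from the
    singularity pass to the limit. *)
Lemma itv0oo_bigcup (R : realType) (F : nat -> R) :
  (forall n, 0 < F n) -> F @ \oo --> 0 ->
  `]0, +oo[%classic = \bigcup_n `[F n, +oo[%classic.
Proof.
move=> F0 Fcvg; apply/seteqP; split => x /=.
  rewrite in_itv/= andbT => x0.
  have /cvgrPdist_lt/(_ _ x0) [n _ /(_ n (leqnn n))] := Fcvg.
  rewrite /= sub0r normrN gtr0_norm// => Fx.
  by exists n => //=; rewrite in_itv/= ltW.
by case=> n _ /=; rewrite !in_itv/= !andbT; exact: lt_le_trans.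
Qed.

(** Monotone convergence in both sides of [integral_gauss_powR] as the lower bound [a = 1/(n+1)]
    decreases to 0; the limit on the right is twice the half-line Gaussian integral. [G n] is the
    image of [F n] under the substitution. *)
Lemma Gamma_half (R : realType) : Gamma (2^-1 : R) = Num.sqrt pi.
Proof.
pose h (x : R) := x `^ (2^-1 - 1) * expR (- x).
have mh : measurable_fun setT h.
  by apply: measurable_funM => //; do 2! apply: measurableT_comp => //.
pose F n : R := n.+1%:R^-1.
have F0 n : 0 < F n by rewrite invr_gt0.
have Fcvg : F @ \oo --> 0 by exact: cvg_harmonic.
pose G n : R := Num.sqrt (F n).
have G0 n : 0 < G n by rewrite sqrtr_gt0.
have Gcvg : G @ \oo --> 0.
  rewrite -[X in _ --> X](@sqrtr0 R).
  by apply: continuous_cvg => //; exact: sqrt_continuous.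
have Fdec m n : (m <= n)%N -> F n <= F m.
  by move=> mn; rewrite lef_pV2 ?posrE// ler_nat.
have nd (K : nat -> R) : (forall m n, (m <= n)%N -> K n <= K m) ->
    nondecreasing_seq (fun n => `[K n, +oo[%classic : set (measurableTypeR R)).
  move=> Kdec m n mn; rewrite subsetEset => x /=; rewrite !in_itv/= !andbT.
  exact/le_trans/Kdec.
have mI (K : nat -> R) n : measurable (`[K n, +oo[%classic : set (measurableTypeR R)) by [].
have cvg1 := @ge0_nondecreasing_set_cvg_integral _ (measurableTypeR R) R
  (fun n => `[F n, +oo[%classic) (EFin \o h) lebesgue_measure (nd _ Fdec) (mI F).
have cvg2 := @ge0_nondecreasing_set_cvg_integral _ (measurableTypeR R) R
  (fun n => `[G n, +oo[%classic) (EFin \o @gauss_fun R) lebesgue_measure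
  (nd G (fun m n mn => ler_wsqrtr (Fdec m n mn))) (mI G).
rewrite -(itv0oo_bigcup _ F F0 Fcvg) in cvg1.
rewrite -(itv0oo_bigcup _ G G0 Gcvg) in cvg2.
rewrite /Gamma /Rintegral.
suff -> : (\int[lebesgue_measure]_(x in `]0%R, +oo[) (x `^ (2^-1 - 1) * expR (- x))%:E)%E
   = (Num.sqrt pi)%:E :> \bar R by [].
rewrite -[LHS]/(\int[lebesgue_measure]_(x in `]0%R, +oo[) ((EFin \o h) x))%E.
have mf i : measurable_fun (`[F i, +oo[%classic : set (measurableTypeR R)) (EFin \o h).
  exact/measurable_funTS/measurable_EFinP.
have mg i : measurable_fun (`[G i, +oo[%classic : set (measurableTypeR R)) (EFin \o @gauss_fun R).
  apply/measurable_EFinP; apply: measurable_funTS; exact: measurable_gauss_fun.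
have h0 i x : `[F i, +oo[%classic x -> (0 <= (EFin \o h) x)%E.
  by move=> _; rewrite lee_fin mulr_ge0// ?powR_ge0 ?expR_ge0.
have g0 i x : `[G i, +oo[%classic x -> (0 <= (EFin \o @gauss_fun R) x)%E.
  by move=> _; rewrite lee_fin gauss_fun_ge0.
have {}cvg1 := cvg1 mf h0.
have {}cvg2 := cvg2 mg g0.
have cvg3 : (fun n => \int[lebesgue_measure]_(x in `[F n, +oo[) (EFin \o h) x)%E @ \oo -->
   (2%:E * \int[lebesgue_measure]_(x in `]0%R, +oo[) (EFin \o @gauss_fun R) x)%E.
  rewrite [X in X @ _ --> _](_ : _ = (fun n => 2%:E *
      \int[lebesgue_measure]_(x in `[G n, +oo[) (EFin \o @gauss_fun R) x)%E).
    exact: cvgeZl.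
  apply/funext => n; rewrite /G -(powR12_sqrt (ltW (F0 n))).
  exact: integral_gauss_powR.
rewrite (cvg_unique _ cvg1 cvg3)//.
rewrite integral_itv_obnd_cbnd; last first.
  by apply/measurable_EFinP; apply: measurable_funTS; exact: measurable_gauss_fun.
by rewrite integral0y_gauss -EFinM mulrCA divff// mulr1.
Qed.

Lemma Gamma1 (R : realType) : Gamma (1 : R) = 1.
Proof.
rewrite /Gamma /Rintegral.
rewrite (_ : (\int[_]_(_ in _) _)%E =
    (\int[@lebesgue_measure R]_(x in `]0%R, +oo[) (expR (- (1 * x)))%:E)%E);
  last first.
  by apply: eq_integral => x _; rewrite subrr powRr0 !mul1r.
rewrite integral_itv_obnd_cbnd; last first.
  apply/measurable_EFinP; apply: measurable_funTS; apply: measurableT_comp => //.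
  by apply: measurableT_comp => //; exact: measurable_funM.
by rewrite integral_expR_itv// mulr0 oppr0 expR0 invr1 mulr1.
Qed.

(** Inverts [1 - x <= expR (- x)] at [x = 1/2]. Both [expR 1 <= 4] and [1/2 <= ln 2] follow from
    it. *)
Lemma expR_half_le2 (R : realType) : expR (2^-1 : R) <= 2.
Proof.
have := expR_ge1Dx (- 2^-1 : R); have := expRxMexpNx_1 (2^-1 : R).
by have := expR_gt0 (2^-1 : R); nra.
Qed.

Lemma expR1_le4 (R : realType) : expR (1 : R) <= 4.
Proof.
rewrite (_ : 1 = 2^-1 + 2^-1 :> R); last by lra.
by rewrite expRD; have := expR_half_le2 R; have := expR_gt0 (2^-1 : R); nra.
Qed.

Lemma ln2_ge_half (R : realType) : 2^-1 <= ln (2 : R).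
Proof. by rewrite -ler_expR lnK ?posrE// expR_half_le2. Qed.

(** On [[1, +oo[] the factor [x^(1/2)] is at least 1, so the integral is at least
    [expR (-1) >= 1/4]. The value sits in the denominator of [cst_d 3], whence a bound from
    below. *)
Lemma Gamma_3half_ge (R : realType) : 4^-1 <= Gamma (3 / 2 : R).
Proof.
rewrite /Gamma /Rintegral.
pose h (x : R) := x `^ (3 / 2 - 1) * expR (- x).
have mexp (c : R) : measurable_fun setT (fun x : R => expR (- (c * x))).
  apply: measurableT_comp => //.
  by apply: measurableT_comp => //; exact: measurable_funM.
have mh : measurable_fun setT h.
  by apply: measurable_funM => //; do 2! apply: measurableT_comp => //.
have h0 x : 0 <= h x by rewrite mulr_ge0 ?powR_ge0 ?expR_ge0.
have hE x : 0 < x -> h x = Num.sqrt x * expR (- x).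
  by move=> x0; rewrite /h (_ : 3 / 2 - 1 = 2^-1) ?powR12_sqrt ?ltW//; lra.
rewrite -[X in fine X]/(\int[@lebesgue_measure R]_(x in `]0%R, +oo[) ((EFin \o h) x))%E.
set I := (\int[_]_(_ in _) _)%E.
(* Serves finiteness only: [fine] would send an infinite integral to 0. *)
have upper : (I <= (2^-1^-1)%:E)%E.
  apply: (@le_trans _ _ (\int[@lebesgue_measure R]_(x in `]0%R, +oo[) (expR (- (2^-1 * x)))%:E)%E).
    apply: ge0_le_integral => //.
    - by move=> x _; rewrite lee_fin h0.
    - by apply/measurable_EFinP; exact: measurable_funTS.
    - by apply/measurable_EFinP; apply: measurable_funTS; exact: mexp.
    - move=> x; rewrite /= in_itv/= andbT lee_fin => x0; rewrite hE//.
      rewrite (_ : - x = - (2^-1 * x) + - (2^-1 * x)); last by lra.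
      rewrite expRD mulrA -[leRHS]mul1r ler_pM2r ?expR_gt0//.
      rewrite expRN ler_pdivrMr ?expR_gt0// mul1r.
      (* With [r = x^(1/2)]: [r <= 1 + r^2 / 2 <= expR (x / 2)], so half of the exponential decay
         absorbs the root. *)
      have s0 := sqrtr_ge0 x; have xE := sqr_sqrtr (ltW x0).
      have := expR_ge1Dx (2^-1 * x); rewrite -[in X in 1 + X]xE.
      by have := sqr_ge0 (Num.sqrt x - 1); nra.
  rewrite integral_itv_obnd_cbnd; last first.
    by apply/measurable_EFinP; exact: measurable_funTS.
  by rewrite integral_expR_itv// mulr0 oppr0 expR0 mulr1.
have lower : ((4^-1)%:E <= I)%E.
  apply: (@le_trans _ _ (\int[@lebesgue_measure R]_(x in `[1%R, +oo[) (expR (- (1 * x)))%:E)%E).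
    rewrite integral_expR_itv// invr1 mul1r mulr1 lee_fin expRN.
    by rewrite lef_pV2 ?posrE ?expR_gt0// expR1_le4.
  apply: (@le_trans _ _ (\int[@lebesgue_measure R]_(x in `[1%R, +oo[) (EFin \o h) x)%E).
    apply: ge0_le_integral => //.
    - by apply/measurable_EFinP; apply: measurable_funTS; exact: mexp.
    - by apply/measurable_EFinP; exact: measurable_funTS.
    - move=> x; rewrite /= in_itv/= andbT lee_fin => x1.
      rewrite hE ?(lt_le_trans _ x1)// mul1r ler_peMl ?expR_ge0//.
      by rewrite -[leLHS]sqrtr1 ler_wsqrtr.
  apply: ge0_subset_integral => //.
  - by apply/measurable_EFinP; exact: measurable_funTS.
  - by move=> x _; rewrite lee_fin.
  - by move=> x; rewrite /= !in_itv/= !andbT; exact: lt_le_trans.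
rewrite -lee_fin fineK// ge0_fin_numE; first exact: le_lt_trans upper (ltry _).
exact: le_trans lower.
Qed.

(** The values for [d] = 1, 2, 3 are 2, [2 pi] and [2 pi^(3/2) / Gamma (3/2)]. In the last case
    [pi^(3/2) <= 8] and [Gamma (3/2) >= 1/4] give exactly [2 * 8 * 4 = 4^3]. *)
Lemma cst_d_bounds (R : realType) (d : nat) : (0 < d <= 3)%N ->
  0 < cst_d d :> R /\ cst_d d <= 4 ^+ d :> R.
Proof.
have pi4 : pi <= 4 :> R by have := @pihalf_lt2 R; lra.
have pi0 := @pi_gt0 R.
have s2 : Num.sqrt pi <= 2 :> R.
  by rewrite -[leRHS]ger0_norm// -sqrtr_sqr ler_wsqrtr// expr2; lra.
have s0 : 0 < Num.sqrt pi :> R by rewrite sqrtr_gt0.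
case: d => [|[|[|[|d]]]] // _; rewrite /cst_d.
- rewrite [1%:R / 2]mul1r Gamma_half powR12_sqrt ?(ltW pi0)//.
  by rewrite mulfK ?lt0r_neq0//; split; lra.
- rewrite divff// Gamma1 powRr1 ?(ltW pi0)// divr1 expr2; split; lra.
- have G := Gamma_3half_ge R; have G0 := lt_le_trans (_ : 0 < 4^-1) G.
  have pE : pi `^ (3 / 2) = pi * Num.sqrt pi :> R.
    rewrite (_ : 3 / 2 = 1 + 2^-1 :> R); last by lra.
    rewrite powRD ?powRr1 ?powR12_sqrt ?(ltW pi0)//.
    by rewrite (gt_eqF pi0) implybT.
  rewrite pE; split; first by rewrite divr_gt0 ?mulr_gt0// G0// invr_gt0.
  rewrite ler_pdivrMr; last by rewrite G0// invr_gt0.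
  rewrite !exprS expr0 mulr1.
  have : pi * Num.sqrt pi <= 8 :> R by nra.
  by lra.
Qed.

(** * Lower bound on the constant for q = 1 *)

Lemma measurable_prod_tnth (R : realType) n (g : measurableTypeR R -> R) :
  measurable_fun setT g ->
  measurable_fun setT (fun x : n.-tuple (measurableTypeR R) => \prod_(i < n) g (tnth x i)).
Proof.
move=> mg; apply: measurable_prod => i _.
exact: (measurableT_comp mg (measurable_tnth i)).
Qed.

(** Induction on [n]: [lebesgue_tuple n.+1] is the image of a product measure under [cons_pair],
    along which the first factor splits off, and Tonelli's theorem applies. *)
Lemma integral_lebesgue_tuple_prod (R : realType) n (g : measurableTypeR R -> R) (I : R) :
  (forall x, 0 <= g x) -> measurable_fun setT g ->
  (\int[@lebesgue_measure R]_x (g x)%:E = I%:E)%E ->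
  (\int[@lebesgue_tuple R n]_x (\prod_(i < n) g (tnth x i))%:E = (I ^+ n)%:E)%E.
Proof.
move=> g0 mg gI; elim: n => [|n IHn].
  rewrite integral_dirac// ?diracT ?mul1e ?big_ord0 ?expr0//.
  by apply/measurable_EFinP; exact: measurable_prod_tnth.
have mf m : measurable_fun setT
    (fun x : m.-tuple (measurableTypeR R) => (\prod_(i < m) g (tnth x i))%:E).
  by apply/measurable_EFinP; exact: measurable_prod_tnth.
have f0 m (x : m.-tuple (measurableTypeR R)) : (0 <= (\prod_(i < m) g (tnth x i))%:E)%E.
  by rewrite lee_fin prodr_ge0.
have fE (z : measurableTypeR R * n.-tuple (measurableTypeR R)) :
    \prod_(i < n.+1) g (tnth (cons_pair z) i) = g z.1 * \prod_(i < n) g (tnth z.2 i).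
  rewrite big_ord_recl /=; congr (_ * _).
  by apply: eq_bigr => i _; rewrite tnthS; congr (g (tnth _ _)); exact: val_inj.
transitivity (\int[lebesgue_measure \x lebesgue_tuple n]_z
    ((g z.1 * \prod_(i < n) g (tnth z.2 i))%:E))%E.
  rewrite /=.
  transitivity (\int[pushforward (lebesgue_measure \x lebesgue_tuple n)
      (@cons_pair R n)]_x (\prod_(i < n.+1) g (tnth x i))%:E)%E => //.
  rewrite ge0_integral_pushforward//.
  - by rewrite preimage_setT; apply: eq_integral => z _; rewrite /= fE.
  - exact: measurable_cons_pair.
  - exact: mf.
pose h (z : measurableTypeR R * n.-tuple (measurableTypeR R)) : \bar R :=
  (g z.1 * \prod_(i < n) g (tnth z.2 i))%:E.
have mh : measurable_fun setT h.
  apply/measurable_EFinP; apply: measurable_funM; first exact: (measurableT_comp mg).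
  apply: (measurableT_comp (measurable_prod_tnth _ n _ mg)); exact: measurable_snd.
have h0 z : (0 <= h z)%E by rewrite lee_fin mulr_ge0// prodr_ge0.
etransitivity; first exact: (@fubini_tonelli1 _ _ _ _ _ _ _ h mh h0).
have hE x : fubini_F (lebesgue_tuple n) h x = ((g x)%:E * (I ^+ n)%:E)%E.
  rewrite -IHn -ge0_integralZl//.
  - exact: mf.
  - by rewrite lee_fin.
under eq_integral do rewrite hE.
rewrite ge0_integralZr//.
- by rewrite gI exprS.
- exact/measurable_EFinP.
- by move=> x _; rewrite lee_fin.
- rewrite lee_fin exprn_ge0// -lee_fin -gI; apply: integral_ge0 => x _.
  by rewrite lee_fin.
Qed.

Lemma euclidean_norm_le_sum (R : realType) d (x : 'rV[R]_d) :
  euclidean_norm x <= \sum_i `|x ord0 i|.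
Proof.
have S0 : 0 <= \sum_i `|x ord0 i| by exact: sumr_ge0.
rewrite /euclidean_norm -[leRHS]ger0_norm// -sqrtr_sqr ler_wsqrtr//.
rewrite expr2 mulr_suml; apply: ler_sum => i _.
rewrite -real_normK ?num_real// expr2 ler_wpM2l//.
by rewrite (bigD1 i)//= lerDl sumr_ge0.
Qed.

Lemma sum_le_euclidean_norm (R : realType) d (x : 'rV[R]_d) :
  \sum_i `|x ord0 i| <= d%:R * euclidean_norm x.
Proof.
rewrite -[X in X%:R * _]card_ord -sum1_card natr_sum mulr_suml.
apply: ler_sum => i _; rewrite mul1r /euclidean_norm -sqrtr_sqr ler_wsqrtr//.
by rewrite (bigD1 i)//= lerDl sumr_ge0// => j _; rewrite sqr_ge0.
Qed.

(** Since the Euclidean norm is at most the l1 norm, the integrand dominates the product of the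
    [expR (- |x_i| / 2)], each of which integrates to 4. *)
Lemma cst_0_q1_ge (R : realType) d : (0 < d)%N -> 4 ^+ d <= @cst_0 R d 1.
Proof.
move=> d0.
pose E (c : R) (x : measurableTypeR R) := expR (- (c * `|x|)).
have mE c : measurable_fun setT (E c).
  do 2! apply: measurableT_comp => //.
  by apply: measurable_funM => //; exact: measurableT_comp.
have E0 c x : 0 <= E c x by exact: expR_ge0.
have IE c : 0 < c ->
    (\int[@lebesgue_tuple R d]_x (\prod_(i < d) E c (tnth x i))%:E =
     ((2 / c) ^+ d)%:E)%E.
  by move=> c0; apply: integral_lebesgue_tuple_prod => //; exact: integral_expR_norm.
have prodE c (x : d.-tuple (measurableTypeR R)) :
    \prod_(i < d) E c (tnth x i) = expR (- (c * \sum_i `|vec x ord0 i|)).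
  rewrite -expR_sum mulr_sumr -sumrN.
  by congr expR; apply: eq_bigr => i _; rewrite mxE.
pose h (x : d.-tuple (measurableTypeR R)) := expR (- (2^-1 * euclidean_norm (vec x) `^ 1)).
have mh : measurable_fun setT h.
  do 2! apply: measurableT_comp => //.
  apply: measurable_funM => //; apply: (@measurableT_comp _ _ _ _ _ _ (@powR R ^~ 1)) => //.
  apply: (@measurableT_comp _ _ _ _ _ _ (@Num.sqrt R)).
    by apply: continuous_measurable_fun; exact: sqrt_continuous.
  apply: measurable_sum => i; apply: measurable_funX.
  rewrite [X in measurable_fun _ X](_ : _ = (fun x => tnth x i)).
    exact: measurable_tnth.
  by apply/funext => x; rewrite mxE.
have hE x : h x = expR (- (2^-1 * euclidean_norm (vec x))).
  by rewrite /h powRr1// sqrtr_ge0.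
rewrite /cst_0 /rint /eint preimage_setT.
rewrite -[X in _ <= fine X]/(\int[@lebesgue_tuple R d]_x (h x)%:E)%E.
(* Again for finiteness: the l1 norm is at most [d] times the Euclidean norm, which gives a product
   of exponentials of rate [1 / (2 d)]. *)
have upper : (\int[@lebesgue_tuple R d]_x (h x)%:E <= ((2 / (2^-1 / d%:R)) ^+ d)%:E)%E.
  rewrite -IE; last by rewrite divr_gt0// ltr0n.
  apply: ge0_le_integral => //.
  - by move=> x _; rewrite lee_fin expR_ge0.
  - exact/measurable_EFinP.
  - by apply/measurable_EFinP; exact: measurable_prod_tnth.
  - move=> x _; rewrite lee_fin prodE hE ler_expR lerN2 -mulrA ler_pM2l//.
    by rewrite ler_pdivrMl ?ltr0n// sum_le_euclidean_norm.
have lower : ((4 ^+ d)%:E <= \int[@lebesgue_tuple R d]_x (h x)%:E)%E.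
  rewrite (_ : 4 = 2 / 2^-1) -?IE//; last by rewrite invrK -natrM.
  apply: ge0_le_integral => //.
  - by move=> x _; rewrite lee_fin prodr_ge0.
  - by apply/measurable_EFinP; exact: measurable_prod_tnth.
  - exact/measurable_EFinP.
  - move=> x _; rewrite lee_fin prodE hE ler_expR lerN2 ler_pM2l//.
    exact: euclidean_norm_le_sum.
rewrite -lee_fin fineK// ge0_fin_numE; first exact: le_lt_trans upper (ltry _).
by apply: le_trans lower; rewrite lee_fin exprn_ge0.
Qed.

(** At [q = 1] the exponent in [cst_q] is [1/d], and [cst_0 >= 4^d >= cst_d] leaves at least the
    d-th root of [2^d]. The resulting 2 compensates [ln 2 >= 1/2]. *)
Lemma r_star_ge1 (R : realType) d (r1 : R) : (0 < d <= 3)%N -> 1 <= r_star d 1 r1.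
Proof.
move=> d3; have /andP[d0 _] := d3; have [c0 c4] := @cst_d_bounds R d d3.
have c01 := @cst_0_q1_ge R d d0.
have ln2 := ln2_ge_half R.
rewrite /r_star.
suff : 2 <= cst_q d (1 : R).
  move=> h; have : cst_q d (1 : R) <= Num.max r1 (cst_q d 1) by rewrite le_max lexx orbT.
  by nra.
rewrite /cst_q ifT; last by lra.
rewrite subrK mulr1.
have dR : d%:R != 0 :> R by rewrite pnatr_eq0 -lt0n.
have {1}-> : (2 : R) = (2 ^+ d) `^ (1 / d%:R).
  by rewrite -powR_mulrn// -powRrM mulrCA divff// mulr1 powRr1.
have p2 : 0 <= (2 : R) ^+ d by rewrite exprn_ge0.
apply: ge0_ler_powR; rewrite ?nnegrE//.
- by rewrite divr_ge0 ?(ltW c0)// mulr_ge0// (le_trans _ c01)// exprn_ge0.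
- by rewrite -mulrA ler_peMr// ler_pdivlMr// mul1r (le_trans c4).
Qed.

(** * Exponential moments of Besov measures *)

(** A density known only through its integrals over sets agrees almost everywhere with the
    Radon-Nikodym derivative, for which the change of variables holds. *)
Lemma ge0_integral_density d (T : measurableType d) (R : realType)
    (mu : {finite_measure set T -> \bar R})
    (nu : {sigma_finite_measure set T -> \bar R}) (f : T -> \bar R) (g : T -> \bar R) :
  measurable_fun setT f ->
  (forall A, measurable A -> mu A = \int[nu]_(x in A) f x)%E ->
  measurable_fun setT g -> (forall x, 0 <= g x)%E ->
  (\int[mu]_x g x = \int[nu]_x (g x * f x))%E.
Proof.
move=> mf muE mg g0.
have munu : mu `<< nu.
  apply/null_content_dominatesP => A mA nuA0; rewrite muE//.
  by apply: null_set_integral => //; exact: measurable_funTS.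
have h0 := Radon_Nikodym_SigmaFinite.f_ge0 munu.
have hi := Radon_Nikodym_SigmaFinite.f_integrable munu.
have mh := measurable_int _ hi.
rewrite -(Radon_Nikodym_SigmaFinite.change_of_variables munu)//.
apply: ae_eq_integral => //; [exact: emeasurable_funM..|].
apply: ae_eqe_mul2l; apply: integral_ae_eq => //.
by move=> A _ mA; rewrite -muE// -Radon_Nikodym_SigmaFinite.f_integral.
Qed.

(** One term of the exponential series, of order [k+1] with [gam * (k+1) >= 2], bounds the summand
    by a multiple of [(l+1)^-2], which is compared with a telescoping series. *)
Lemma sum_expR_powR_bounded (R : realType) (del gam : R) : 0 < del -> 0 < gam ->
  exists2 C : R, 0 <= C & forall N, \sum_(0 <= l < N) expR (- (del * l.+1%:R `^ gam)) <= C.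
Proof.
move=> d0 g0.
have [k kg] : exists k : nat, 2 <= gam * k.+1%:R.
  have [k _ /(_ k (leqnn k)) kg] := nbhs_infty_ger (2 / gam).
  exists k; rewrite mulrC -ler_pdivrMr//; apply: (le_trans kg).
  by rewrite ler_nat.
(* Chosen so that [x = del * (l+1)^gam] satisfies [(l+1)^2 / K <= x^(k+1) / (k+1)!]. *)
pose K : R := k.+1`!%:R / del ^+ k.+1.
have K0 : 0 < K by rewrite divr_gt0 ?exprn_gt0// ltr0n fact_gt0.
have term l : expR (- (del * l.+1%:R `^ gam)) <= 2 * K * (l.+1%:R^-1 - l.+2%:R^-1).
  have l1 : 1 <= l.+1%:R :> R by rewrite ler1n.
  have l0 : 0 < l.+1%:R :> R by rewrite ltr0n.
  set x := del * _.
  have x0 : 0 < x by rewrite mulr_gt0// powR_gt0.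
  have h1 : x ^+ k.+1 / k.+1`!%:R <= expR x.
    by apply: le_trans (expR_ge1Dxn k (ltW x0)); rewrite lerDr.
  have h2 : l.+1%:R ^+ 2 / K <= x ^+ k.+1 / k.+1`!%:R.
    rewrite /K invf_div mulrA ler_pM2r ?invr_gt0 ?ltr0n ?fact_gt0//.
    rewrite exprMn mulrC ler_pM2l ?exprn_gt0//.
    rewrite -(powR_mulrn 2 (ltW l0)) -(powR_mulrn _ (powR_ge0 _ _)) -powRrM.
    exact: ler_powR.
  rewrite expRN.
  have h3 := le_trans h2 h1.
  apply: (@le_trans _ _ (K / l.+1%:R ^+ 2)).
    rewrite -[leRHS]invrK lef_pV2 ?posrE ?expR_gt0 ?invr_gt0 ?divr_gt0 ?exprn_gt0//.
    by rewrite invf_div.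
  rewrite [2 * K]mulrC -[K * 2 * _]mulrA ler_pM2l//.
  have l2 : 0 < l.+2%:R :> R by rewrite ltr0n.
  have -> : l.+1%:R^-1 - l.+2%:R^-1 = (l.+1%:R * l.+2%:R)^-1 :> R.
    field.
    by rewrite !lt0r_neq0 //; have := ler0n R l; lra.
  rewrite -[2]invrK -invfM lef_pV2 ?posrE ?exprn_gt0 ?mulr_gt0//.
  rewrite expr2 mulrCA ler_pM2l//.
  by rewrite -[l.+2]addn1 -[l.+1 in leLHS]addn1 !natrD; have := ler0n R l; lra.
have K20 : 0 <= 2 * K by rewrite mulr_ge0// ltW.
exists (2 * K) => //.
move=> N; apply: (@le_trans _ _ (\sum_(0 <= l < N) 2 * K * (l.+1%:R^-1 - l.+2%:R^-1))).
  exact: ler_sum.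
rewrite -mulr_sumr ler_piMr//.
have -> : \sum_(0 <= l < N) (l.+1%:R^-1 - l.+2%:R^-1) = 1 - N.+1%:R^-1 :> R.
  elim: N => [|N IH]; first by rewrite big_nil invr1 subrr.
  by rewrite big_nat_recr//= IH addrA subrK.
by rewrite gerBl.
Qed.

(** For [q = 1] the rate [eps] is the slack [1/2 - b]. For [q > 1] the power outgrows every linear
    term beyond a threshold, and [K] covers the bounded range below it. *)
Lemma exp_tail_bound (R : realType) (q b : R) : 1 <= q -> 0 <= b ->
  (q = 1 -> b < 2^-1) ->
  exists K eps : R, 0 < eps /\
    forall y, 0 <= y -> b * y - 2^-1 * y `^ q <= K - eps * y.
Proof.
move=> q1 b0 hb; have [q1'|q1'] := eqVneq q 1.
  exists 0, (2^-1 - b); split; first by rewrite subr_gt0 hb.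
  by move=> y y0; rewrite q1' powRr1//; lra.
have {q1'}q1 : 0 < q - 1 by rewrite subr_gt0 lt_neqAle eq_sym q1' q1.
(* The threshold at which [y^(q-1) = 2 (b+1)]; beyond it half of [y^q] is at least [(b+1) y]. *)
pose y0 := (2 * (b + 1)) `^ (q - 1)^-1.
have y00 : 0 <= y0 by exact: powR_ge0.
exists ((b + 1) * y0), 1; split=> // y yge0.
have [yy0|yy0] := leP y y0.
  have h1 : (b + 1) * y <= (b + 1) * y0 by rewrite ler_wpM2l// addr_ge0.
  have := powR_ge0 y q; lra.
have h2 : 2 * (b + 1) <= y `^ (q - 1).
  rewrite (_ : 2 * (b + 1) = y0 `^ (q - 1)).
    by apply: ge0_ler_powR; rewrite ?nnegrE// ltW.
  by rewrite /y0 -powRrM mulVf ?lt0r_neq0// powRr1// mulr_ge0// addr_ge0.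
have : 2 * (b + 1) * y <= y `^ q.
  rewrite -mulr_powRB1//; last by lra.
  by rewrite mulrC ler_wpM2l.
have : 0 <= (b + 1) * y0 by rewrite mulr_ge0// addr_ge0.
by lra.
Qed.

Lemma besov_density_exp_moment (R : realType) (q b : R) : 1 <= q -> 0 <= b ->
  (q = 1 -> b < 2^-1) ->
  (\int[@lebesgue_measure R]_x ((expR (b * `|x|))%:E * (besov_density q x)%:E) < +oo)%E.
Proof.
move=> q1 b0 hb; have [K [eps [e0 bound]]] := exp_tail_bound _ _ _ q1 b0 hb.
rewrite /besov_density; set c := \int[_]_z _.
have c0 : 0 <= c^-1 by rewrite invr_ge0; apply: Rintegral_ge0 => x _; exact: expR_ge0.
have mexp : measurable_fun setT (fun x : measurableTypeR R => expR (- (eps * `|x|))).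
  do 2! apply: measurableT_comp => //.
  by apply: measurable_funM => //; exact: measurableT_comp.
have mnorm (k : R) : measurable_fun setT (fun x : measurableTypeR R => expR (k * `|x|)).
  apply: measurableT_comp => //.
  by apply: measurable_funM => //; exact: measurableT_comp.
apply: (@le_lt_trans _ _ (\int[@lebesgue_measure R]_x
    ((c^-1 * expR K)%:E * (expR (- (eps * `|x|)))%:E))%E).
  apply: ge0_le_integral => //.
  - by move=> x _; rewrite mule_ge0// lee_fin ?mulr_ge0 ?expR_ge0.
  - apply: emeasurable_funM; apply/measurable_EFinP => //.
    apply: measurable_funM => //; do 2! apply: measurableT_comp => //.
    apply: measurable_funM => //.
    apply: (@measurableT_comp _ _ _ _ _ _ (@powR R ^~ q)) => //.
  - apply: emeasurable_funM => //; exact/measurable_EFinP.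
  - move=> x _; rewrite -!EFinM lee_fin mulrA -expRD [leLHS]mulrC -mulrA ler_wpM2l//.
    by rewrite -expRD ler_expR bound.
rewrite ge0_integralZl//.
- by rewrite integral_expR_norm// -EFinM ltry.
- exact/measurable_EFinP.
- by rewrite lee_fin mulr_ge0// expR_ge0.
Qed.

(** [V] is [expR a] plus the series of the tail terms, a single integrable majorant of the
    exponential of the supremum. It takes values in the extended reals because the series may
    diverge on a null set. *)
Lemma exp_sup_moment (R : realType) d (T : measurableType d) (P : probability T R)
    (xi : nat -> {RV P >-> measurableTypeR R}) (a b gam K : R) :
  0 < a -> a < b -> 0 < gam ->
  (forall l, \int[P]_w (expR (b * `|xi l w|))%:E <= K%:E)%E ->
  exists V : T -> \bar R, [/\ measurable_fun setT V, (\int[P]_w V w < +oo)%E,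
    forall w, (1 <= V w)%E &
    forall w l, ((expR (a * (l.+1%:R `^ (- gam) * `|xi l w|)))%:E <= V w)%E].
Proof.
move=> a0 ab g0 bK.
have b0 := lt_trans a0 ab.
have ba : 0 < b - a by rewrite subr_gt0.
have [C C0 hC] := sum_expR_powR_bounded _ _ _ ba g0.
have K0 : 0 <= K.
  rewrite -lee_fin; apply: le_trans (bK 0%N); apply: integral_ge0 => w _.
  by rewrite lee_fin expR_ge0.
pose c l := expR (- ((b - a) * l.+1%:R `^ gam)).
pose term l w := ((c l)%:E * (expR (b * `|xi l w|))%:E)%E.
have t0 l w : (0 <= term l w)%E by rewrite /term -EFinM lee_fin mulr_ge0 ?expR_ge0.
have mxi l : measurable_fun setT (fun w => (expR (b * `|xi l w|))%:E).
  apply/measurable_EFinP; apply: measurableT_comp => //.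
  by apply: measurable_funM => //; exact: measurableT_comp.
have mt l : measurable_fun setT (term l) by exact: emeasurable_funM.
pose S w := (\sum_(l <oo) term l w)%E.
have S0 w : (0 <= S w)%E by exact: nneseries_ge0.
have mS : measurable_fun setT S.
  by apply: ge0_emeasurable_sum => // l w _ _.
exists (fun w => (expR a)%:E + S w)%E; split.
- exact: emeasurable_funD.
- rewrite ge0_integralD//.
  rewrite integral_cst// [X in (_ * X + _)%E](_ : _ = 1%E) ?mule1; last exact: probability_setT.
  apply: lte_add_pinfty; first exact: ltry.
  rewrite integral_nneseries//.
  apply: (@le_lt_trans _ _ (K * C)%:E); last exact: ltry.
  apply: lime_le.
    apply: is_cvg_nneseries => n _ _; apply: integral_ge0 => w _; exact: t0.
  apply: nearW => N.
  apply: (@le_trans _ _ (\sum_(0 <= l < N) (K * c l)%:E)%E).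
    apply: lee_sum => l _; rewrite ge0_integralZl ?lee_fin ?expR_ge0//.
    by rewrite mulrC EFinM; apply: lee_wpmul2l => //; rewrite lee_fin expR_ge0.
  by rewrite sumEFin lee_fin -mulr_sumr ler_wpM2l.
- move=> w; apply: le_trans (leeDl _ (S0 w)).
  by rewrite lee_fin ltW// expR_gt1.
- move=> w l; have l1 : 1 <= l.+1%:R :> R by rewrite ler1n.
  have p0 : 0 < l.+1%:R `^ gam :> R by rewrite powR_gt0// ltr0n.
  have [small|big] := leP `|xi l w| (l.+1%:R `^ gam).
    apply: le_trans (leeDl _ (S0 w)).
    rewrite lee_fin ler_expR ler_piMr ?(ltW a0)//.
    by rewrite powRN mulrC ler_pdivrMr// mul1r.
  apply: le_trans (leeDr _ _); last by rewrite lee_fin expR_ge0.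
  apply: (@le_trans _ _ (term l w)); last first.
    apply: (@le_trans _ _ (\sum_(0 <= i < l.+1) term i w)%E).
      by rewrite big_nat_recr//= leeDr// sume_ge0.
    exact: nneseries_lim_ge.
  (* Here [|xi l w|] exceeds [l.+1^gam], so [a |xi| = b |xi| - (b - a) |xi|] is at most
     [b |xi| - (b - a) l.+1^gam]. *)
  rewrite /term -EFinM lee_fin -expRD ler_expR.
  have h1 : l.+1%:R `^ (- gam) <= 1 :> R.
    by rewrite powRN invf_le1// -[leLHS](powRr0 l.+1%:R) ler_powR// ltW.
  have : a * (l.+1%:R `^ (- gam) * `|xi l w|) <= a * `|xi l w|.
    by rewrite ler_pM2l// ler_piMl.
  have : (b - a) * l.+1%:R `^ gam <= (b - a) * `|xi l w|.
    by rewrite ler_pM2l// ltW.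
  by lra.
Qed.

(** * Finite wavelet expansions and their images under the embedding *)

Section finite_expansion.
Context (R : realType) (d : nat) (psi : nat -> 'rV[R]_d -> R).

(** The partial sums of a wavelet series, seen as distributions. They belong to every [C^t], so the
    embedding can be applied to them although the random series itself is summed in [X]. *)
Definition finite_expansion (a : nat -> R) (N : nat) : @test_function R d -> R :=
  fun h => \sum_(0 <= l < N) a l * distr_of (psi l) h.

(** The coefficients extended by 0 beyond [N] are one candidate in the infimum defining the norm;
    their partial sums are constant from rank [N] on. *)
Lemma holder_norm_finite_expansion (t m : R) a N : 0 <= m ->
  (forall l, (l < N)%N -> l.+1%:R `^ (t / d%:R + 2^-1) * `|a l| <= m) ->
  (holder_norm psi t (finite_expansion a N) <= m%:E)%E.
Proof.
move=> m0 am; pose b l := if (l < N)%N then a l else 0.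
apply: (@le_trans _ _ (ereal_sup (range (fun l : nat =>
          (l.+1%:R `^ (t / d%:R + 2^-1) * `|b l|)%:E)))).
  apply: ereal_inf_lbound; exists b => // h.
  apply: cvg_near_cst; exists N => // n /= Nn.
  rewrite /finite_expansion (big_cat_nat (n := N))//=.
  rewrite [X in _ + X]big_nat_cond [X in _ + X]big1 ?addr0.
    by apply: eq_big_nat => l /= lN; rewrite /b lN.
  by move=> l; rewrite andbT => /andP[Nl _]; rewrite /b ltnNge Nl/= mul0r.
apply: ge_ereal_sup => _ [l _ <-]; rewrite lee_fin /b.
by case: ifPn => [/am//|_]; rewrite normr0 mulr0.
Qed.

Lemma holder_space_finite_expansion (t : R) a N :
  holder_space psi t (finite_expansion a N).
Proof.
pose m := \sum_(0 <= l < N) l.+1%:R `^ (t / d%:R + 2^-1) * `|a l|.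
have m0 l : 0 <= l.+1%:R `^ (t / d%:R + 2^-1) * `|a l|.
  by rewrite mulr_ge0// powR_ge0.
rewrite /holder_space /=; apply: le_lt_trans (ltry m).
apply: holder_norm_finite_expansion; first exact: sumr_ge0.
move=> l lN; rewrite /m (big_cat_nat (n := l.+1))//= big_nat_recr//=.
rewrite addrAC lerDr addr_ge0// sumr_ge0//.
Qed.

Lemma distr_ofE l :
  distr_of (psi l) = finite_expansion (fun i => (i == l)%:R) l.+1.
Proof.
apply/funext => h; rewrite /finite_expansion big_nat_recr//= eqxx mul1r.
rewrite big_nat_cond big1 ?add0r// => i; rewrite andbT => /andP[_ il].
by rewrite (ltn_eqF il) mul0r.
Qed.

Lemma holder_embedding_finite_expansion (X : normedModType R) (t : R)
    (iota : (@test_function R d -> R) -> X) ce (a : nat -> R) N :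
  holder_embedding psi t iota ce ->
  iota (finite_expansion a N) = \sum_(0 <= l < N) a l *: iota (distr_of (psi l)).
Proof.
case=> lin _ _; elim: N => [|N IHN].
  (* The empty expansion is the zero distribution [T]; writing [T = 1 * T + T] turns linearity into
     [iota T = iota T + iota T], hence [iota T = 0]. *)
  have fE : finite_expansion a 0 =
      fun h => 1 * finite_expansion a 0 h + finite_expansion a 0 h.
    by apply/funext => h; rewrite /finite_expansion big_nil mulr0 addr0.
  have := lin 1 (finite_expansion a 0) (finite_expansion a 0)
    (holder_space_finite_expansion _ _ _) (holder_space_finite_expansion _ _ _).
  rewrite -fE scale1r big_nil => /eqP.
  by rewrite -subr_eq subrr => /eqP <-.
rewrite big_nat_recr//= -IHN addrC -lin.
- by congr iota; apply/funext => h; rewrite /finite_expansion big_nat_recr//= addrC.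
- by rewrite distr_ofE; exact: holder_space_finite_expansion.
- exact: holder_space_finite_expansion.
Qed.

(** The sign of [ce] is arbitrary, and replacing the norm by its bound [m] requires multiplication
    by a nonnegative constant, whence [Num.max ce 0]. *)
Lemma holder_embedding_le (X : normedModType R) (t : R)
    (iota : (@test_function R d -> R) -> X) ce (a : nat -> R) N m :
  holder_embedding psi t iota ce -> 0 <= m ->
  (forall l, (l < N)%N -> l.+1%:R `^ (t / d%:R + 2^-1) * `|a l| <= m) ->
  `|\sum_(0 <= l < N) a l *: iota (distr_of (psi l))| <= Num.max ce 0 * m.
Proof.
move=> emb m0 am; rewrite -(holder_embedding_finite_expansion _ _ _ _ _ _ emb).
have [_ _ /(_ _ (holder_space_finite_expansion t a N)) h] := emb.
rewrite -lee_fin; apply: (le_trans h); rewrite EFinM.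
have n0 : (0 <= holder_norm psi t (finite_expansion a N))%E.
  apply: le_ereal_inf_tmp => _ [b _ ->].
  apply: (@le_trans _ _ (1%:R `^ (t / d%:R + 2^-1) * `|b 0%N|)%:E).
    by rewrite lee_fin mulr_ge0// powR_ge0.
  by apply: ereal_sup_ubound; exists 0%N.
apply: (@le_trans _ _ ((Num.max ce 0)%:E * holder_norm psi t (finite_expansion a N))%E).
  by apply: lee_wpmul2r => //; rewrite lee_fin le_max lexx.
apply: lee_wpmul2l; first by rewrite lee_fin le_max lexx orbT.
exact: holder_norm_finite_expansion.
Qed.

End finite_expansion.

(** * From pathwise bounds on the random series to the exponential moment *)

Lemma continuous_measurable_borel (R : realType) (X : normedModType R) (f : X -> R) :
  continuous f -> measurable_fun [set: borel X] (f : borel X -> R).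
Proof.
move=> /continuousP cf; apply: (measurability _ (RGenOpens.measurableE R)).
move=> _ [_ [a [b ->] <-]]; rewrite setTI; apply: sub_sigma_algebra.
exact/cf/interval_open.
Qed.

(** The exponent [t/d + 1/2] of the norm and the exponent [-(s/d + 1/2 - 1/q)] of the series add up
    to [-((s - t)/d - 1/q)]. *)
Lemma partial_sum_norm_bound (R : realType) (d : nat) (psi : nat -> 'rV[R]_d -> R)
    (X : normedModType R) (t : R) (iota : (@test_function R d -> R) -> X)
    (ce s q k m : R) (x : nat -> R) (N : nat) :
  holder_embedding psi t iota ce -> 0 <= m -> 0 <= k ->
  (forall l, (l < N)%N -> l.+1%:R `^ (- ((s - t) / d%:R - q^-1)) * `|x l| <= m) ->
  `|\sum_(0 <= l < N) (l.+1%:R `^ (- (s / d%:R + 2^-1 - q^-1)) * k * x l)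
      *: iota (distr_of (psi l))| <= Num.max ce 0 * (k * m).
Proof.
move=> emb m0 k0 xm.
apply: (holder_embedding_le _ _ _ _ _ _ _
  (fun l => l.+1%:R `^ (- (s / d%:R + 2^-1 - q^-1)) * k * x l) N _ emb).
  exact: mulr_ge0.
move=> l /xm {}xm.
rewrite !normrM (ger0_norm k0) (ger0_norm (powR_ge0 _ _)).
rewrite !mulrA -powRD; last by rewrite pnatr_eq0 implybT.
rewrite (_ : _ + _ = - ((s - t) / d%:R - q^-1)); last by rewrite mulrBl; ring.
by rewrite -mulrA mulrCA ler_wpM2l.
Qed.

(** A statement about one outcome. Taking logarithms, all weighted coefficients are at most
    [ln V / a], so all partial sums obey one norm bound, which their limit in [X] inherits. The
    hypothesis [1 <= V] makes this bound nonnegative. *)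
Lemma norm_lim_exp_le (R : realType) (d : nat) (psi : nat -> 'rV[R]_d -> R)
    (X : normedModType R) (t : R) (iota : (@test_function R d -> R) -> X)
    (ce s q k a alpha : R) (x : nat -> R) (u : X) (V : \bar R) :
  holder_embedding psi t iota ce -> 0 <= k -> 0 < a -> 0 < alpha ->
  alpha * Num.max ce 0 * k <= a -> (1 <= V)%E ->
  (forall l, ((expR (a * (l.+1%:R `^ (- ((s - t) / d%:R - q^-1)) * `|x l|)))%:E <= V)%E) ->
  (fun N => \sum_(0 <= l < N) (l.+1%:R `^ (- (s / d%:R + 2^-1 - q^-1)) * k * x l)
      *: iota (distr_of (psi l))) @ \oo --> u ->
  ((expR (alpha * `|u|))%:E <= V)%E.
Proof.
move=> emb k0 a0 al0 ca; case: V => [v||//]; last by move=> *; rewrite leey.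
rewrite lee_fin => v1 xv cvgu; rewrite lee_fin.
have v0 := lt_le_trans ltr01 v1.
have lnvK : expR (ln v) = v by rewrite lnK// posrE.
have lnv0 : 0 <= ln v by exact: ln_ge0.
have xm l : l.+1%:R `^ (- ((s - t) / d%:R - q^-1)) * `|x l| <= ln v / a.
  rewrite ler_pdivlMr// [_ * a]mulrC -ler_expR lnvK.
  by have := xv l; rewrite lee_fin.
have ub : `|u| <= Num.max ce 0 * (k * (ln v / a)).
  apply: (cvgr_to_le (cvg_norm cvgu)); apply: nearW => N.
  apply: (partial_sum_norm_bound _ _ _ _ t _ _ _ _ _ _ x N emb) => //.
  by rewrite divr_ge0// ltW.
rewrite -[leRHS]lnvK ler_expR.
apply: (@le_trans _ _ (alpha * (Num.max ce 0 * (k * (ln v / a))))).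
  by rewrite ler_pM2l.
have -> : alpha * (Num.max ce 0 * (k * (ln v / a))) =
   (alpha * Num.max ce 0 * k) / a * ln v by ring.
by rewrite ler_piMl// ler_pdivrMr// mul1r.
Qed.

(** Wherever the series converges, [expR (alpha |u|)] is below the integrable [V] of
    [exp_sup_moment]; the moment that lemma asks for is the same for all [xi l], as they share one
    density. *)
Lemma besov_measure_exp_moment (R : realType) (d : nat) (psi : nat -> 'rV[R]_d -> R)
    (X : normedModType R) (t : R) (iota : (@test_function R d -> R) -> X)
    (ce s q kappa alpha : R) (mu0 : probability (borel X) R) :
  (0 < d)%N -> holder_embedding psi t iota ce ->
  1 <= q -> t + d%:R / q < s -> 0 < kappa -> 0 < alpha ->
  (q = 1 -> 2 * Num.max ce 0 * alpha < kappa) ->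
  besov_measure psi iota kappa s q mu0 ->
  (\int[mu0]_u (expR (alpha * `|u : X|))%:E < +oo)%E.
Proof.
move=> d0 emb q1 ts k0 al0 hk [dO] [W] [P] [xi] [u] [_ xid cvgu mu0E].
have dR : 0 < d%:R :> R by rewrite ltr0n.
pose gam := (s - t) / d%:R - q^-1.
have gam0 : 0 < gam.
  rewrite subr_gt0 ltr_pdivlMr// mulrC.
  by move: ts; lra.
pose k := kappa^-1 `^ q^-1.
have k0' : 0 <= k by exact: powR_ge0.
pose c := alpha * Num.max ce 0 * k.
have m0 : 0 <= Num.max ce 0 by rewrite le_max lexx orbT.
have c0 : 0 <= c by rewrite /c !mulr_ge0// ltW.
(* For [q > 1] there is no upper limit on [b]. For [q = 1] the condition on [kappa] says [c < 1/2];
   [a] is [c] raised to at least [1/4], hence positive, and [b] is the midpoint of [a] and [1/2]. *)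
have [a [b [a0 ab ca hb]]] : exists a b, [/\ 0 < a, a < b, c <= a & q = 1 -> b < 2^-1].
  have [q1'|q1'] := eqVneq q 1; last first.
    exists (c + 1), (c + 2); split; try lra.
  have c2 : c < 2^-1.
    rewrite /c /k q1' invr1 powRr1 ?invr_ge0 ?(ltW k0)// ltr_pdivrMr//.
    by have := hk q1'; lra.
  pose a := Num.max c 4^-1.
  have a2 : a < 2^-1 by rewrite gt_max c2/=; lra.
  exists a, ((a + 2^-1) / 2); split; try lra.
  - by rewrite lt_max; apply/orP; right; lra.
  - by rewrite le_max lexx.
have b0 : 0 <= b by lra.
have mexp : measurable_fun setT (fun x : measurableTypeR R => (expR (b * `|x|))%:E).
  apply/measurable_EFinP; apply: measurableT_comp => //.
  by apply: measurable_funM => //; exact: measurableT_comp.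
have mdens : measurable_fun setT (fun x : measurableTypeR R => (besov_density q x)%:E).
  apply/measurable_EFinP; apply: measurable_funM => //; do 2! apply: measurableT_comp => //.
  apply: measurable_funM => //.
  by apply: (@measurableT_comp _ _ _ _ _ _ (@powR R ^~ q)) => //.
have momE l : (\int[P]_w (expR (b * `|xi l w|))%:E =
   \int[@lebesgue_measure R]_x ((expR (b * `|x|))%:E * (besov_density q x)%:E))%E.
  rewrite -(ge0_integral_density _ _ _ (distribution P (xi l))) //.
  - by rewrite ge0_integral_distribution// => x; rewrite lee_fin expR_ge0.
  - by move=> A mA; exact: xid.
have momlt := besov_density_exp_moment _ _ _ q1 b0 hb.
set M := (\int[_]_x _)%E in momE momlt.
have Mfin : M \is a fin_num.
  rewrite ge0_fin_numE// -(momE 0%N); apply: integral_ge0 => w _.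
  by rewrite lee_fin expR_ge0.
have [V [mV Vlt V1 hV]] := exp_sup_moment _ _ _ P xi a b gam (fine M) a0 ab gam0
  (fun l => ltac:(by rewrite fineK// momE)).
have mX : measurable_fun setT (fun x : borel X => (expR (alpha * `|x : X|))%:E).
  apply/measurable_EFinP; apply: measurableT_comp => //.
  apply: measurable_funM => //; apply: continuous_measurable_borel.
  exact: norm_continuous.
rewrite (eq_measure_integral (distribution P u)); last by move=> A mA _; exact: mu0E.
rewrite ge0_integral_distribution//.
apply: le_lt_trans Vlt; apply: ae_ge0_le_integral => //.
- by move=> w _; rewrite lee_fin expR_ge0.
- exact: measurableT_comp.
- by move=> w _; exact: le_trans (V1 w).
apply: filterS cvgu => w cvgw _ /=.
apply: (norm_lim_exp_le _ _ _ _ t _ ce s q k a _ _ _ _ emb) => //.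
  exact: hV.
exact: cvgw.
Qed.

(** * Hellinger distance and densities *)

Section hellinger_density.
Local Open Scope charge_scope.
Context (R : realType) (disp : measure_display) (T : measurableType disp).

Lemma has_density_integral (mu nu : probability T R) (f : T -> R) A :
  measurable_fun setT f -> has_density mu nu f -> measurable A ->
  (mu A = \int[nu]_(x in A) (f x)%:E)%E.
Proof.
move=> mf [munu fE] mA.
transitivity (charge_of_finite_measure mu A) => //.
rewrite (@Radon_Nikodym_integral _ _ _ (charge_of_finite_measure mu) nu)//.
apply: ae_eq_integral => //.
- by apply: measurable_funTS.
- by apply: measurable_funTS; apply/measurable_EFinP.
- exact: ae_eq_subset fE.
Qed.

(** A positive function with zero integral over [A] forces [A] to be null. This transfers absolute
    continuity of the reference measure from the posterior to the prior. *)
Lemma has_density_dominates (mu mu0 : probability T R) (f : T -> R) :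
  measurable_fun setT f -> (forall x, 0 < f x) -> has_density mu mu0 f ->
  mu0 `<< mu.
Proof.
move=> mf f0 fd; apply/null_content_dominatesP => A mA muA0.
have If0 := has_density_integral _ _ _ _ mf fd mA; rewrite [LHS]muA0 in If0.
have mfA : measurable_fun A (EFin \o f).
  by apply/measurable_EFinP; exact: measurable_funTS.
have /(ae_eq_integral_abs _ mA mfA) [N [mN N0 AN]] :
    (\int[mu0]_(x in A) `|(EFin \o f) x| = 0)%E.
  by rewrite [RHS]If0; apply: eq_integral => x _; rewrite /= gtr0_norm.
apply: (subset_measure0 mA mN) => // x Ax; apply: AN => /= /(_ Ax) [fx0].
by have := f0 x; rewrite fx0 ltxx.
Qed.

(** The chain rule for densities: both sides have the same integral over every measurable set. *)
Lemma ae_eq_density_chain (mu mu0 : probability T R) (f : T -> R)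
    (nu : {sigma_finite_measure set T -> \bar R}) :
  measurable_fun setT f -> (forall x, 0 <= f x) -> has_density mu mu0 f ->
  mu0 `<< nu ->
  ae_eq nu setT ('d (charge_of_finite_measure mu) '/d nu)
    (fun x => (f x)%:E * Radon_Nikodym_SigmaFinite.f mu0 nu x)%E.
Proof.
move=> mf f0 fd mu0nu.
have munu := null_dominates_trans (proj1 fd) mu0nu.
have hi := Radon_Nikodym_SigmaFinite.f_integrable mu0nu.
have mh := measurable_int _ hi.
apply: integral_ae_eq => //.
- exact: Radon_Nikodym_integrable.
- by apply: emeasurable_funM => //; apply/measurable_EFinP.
- move=> A _ mA; rewrite -Radon_Nikodym_integral//.
  rewrite Radon_Nikodym_SigmaFinite.change_of_variables//.
  + exact: has_density_integral.
  + by apply: measurable_funTS; apply/measurable_EFinP.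
Qed.

(** Independence of the reference measure: with [h] the density of [mu0] with respect to [nu], the
    two densities are [f h] and [f' h], and the squared difference of their roots carries exactly
    one factor [h]. *)
Lemma hellinger_has_density (mu mu' mu0 : probability T R) (f f' : T -> R)
    (nu : {sigma_finite_measure set T -> \bar R}) :
  measurable_fun setT f -> measurable_fun setT f' ->
  (forall x, 0 <= f x) -> (forall x, 0 <= f' x) ->
  has_density mu mu0 f -> has_density mu' mu0 f' -> mu0 `<< nu ->
  hellinger nu mu mu' =
    Num.sqrt (2^-1 * \int[mu0]_x (Num.sqrt (f x) - Num.sqrt (f' x)) ^+ 2).
Proof.
move=> mf mf' f0 f'0 fd f'd mu0nu; rewrite /hellinger /Rintegral.
congr (Num.sqrt (_ * fine _)).
have msqrt : measurable_fun setT (@Num.sqrt R).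
  by apply: continuous_measurable_fun; exact: sqrt_continuous.
have h0 := Radon_Nikodym_SigmaFinite.f_ge0 mu0nu.
have hfin := Radon_Nikodym_SigmaFinite.f_fin_num mu0nu.
have mh := measurable_int _ (Radon_Nikodym_SigmaFinite.f_integrable mu0nu).
have mg : measurable_fun setT (fun x => ((Num.sqrt (f x) - Num.sqrt (f' x)) ^+ 2)%:E).
  apply/measurable_EFinP; apply: measurable_funX.
  by apply: measurable_funB; exact: measurableT_comp.
rewrite -(Radon_Nikodym_SigmaFinite.change_of_variables mu0nu)//; last first.
  by move=> x; rewrite lee_fin sqr_ge0.
have munu := null_dominates_trans (proj1 fd) mu0nu.
have mu'nu := null_dominates_trans (proj1 f'd) mu0nu.
apply: ae_eq_integral => //.
- apply/measurable_EFinP; apply: measurable_funX.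
  by apply: measurable_funB; (apply: measurableT_comp => //; apply: measurableT_comp => //).
- exact: emeasurable_funM.
have e1 := ae_eq_density_chain _ _ _ _ mf f0 fd mu0nu.
have e2 := ae_eq_density_chain _ _ _ _ mf' f'0 f'd mu0nu.
move: e1 e2; apply: filterS2 => x e1 e2 _.
rewrite e1// e2//.
move: (h0 x) (hfin x); case: (Radon_Nikodym_SigmaFinite.f mu0 nu x) => // h.
rewrite lee_fin => hx _; rewrite -!EFinM /=; congr EFin.
by rewrite !sqrtrM// -mulrBl exprMn sqr_sqrtr.
Qed.

End hellinger_density.

(* With g = sqrt p, g' = sqrt p' and a = |g|, b = |g'| in L^2, the left-hand
   integral equals (|g - g'|^2 - (a - b)^2) / (a b). *)
Lemma Rintegral_normalized_sqrt_dist (R : realType) (disp : measure_display)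
    (T : measurableType disp) (mu0 : probability T R) (p p' : T -> R) (z0 : R) :
  measurable_fun setT p -> measurable_fun setT p' ->
  (forall x, 0 <= p x) -> (forall x, 0 <= p' x) ->
  mu0.-integrable setT (EFin \o p) -> mu0.-integrable setT (EFin \o p') ->
  let Z := \int[mu0]_x p x in let Z' := \int[mu0]_x p' x in
  0 < z0 -> z0 <= Z -> z0 <= Z' ->
  \int[mu0]_x (Num.sqrt (p x / Z) - Num.sqrt (p' x / Z')) ^+ 2 <=
  z0^-1 * \int[mu0]_x (Num.sqrt (p x) - Num.sqrt (p' x)) ^+ 2.
Proof.
move=> mp mp' p0 p'0 ip ip' Z Z' z00 zZ zZ'.
have Z0 : 0 < Z by exact: lt_le_trans zZ.
have Z'0 : 0 < Z' by exact: lt_le_trans zZ'.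
pose a := Num.sqrt Z; pose b := Num.sqrt Z'.
have a0 : 0 < a by rewrite sqrtr_gt0.
have b0 : 0 < b by rewrite sqrtr_gt0.
have aE : a ^+ 2 = Z by rewrite sqr_sqrtr// ltW.
have bE : b ^+ 2 = Z' by rewrite sqr_sqrtr// ltW.
have msqrt : measurable_fun setT (@Num.sqrt R).
  by apply: continuous_measurable_fun; exact: sqrt_continuous.
pose D x := (Num.sqrt (p x) - Num.sqrt (p' x)) ^+ 2.
have mD : measurable_fun setT D.
  by apply: measurable_funX; apply: measurable_funB; exact: measurableT_comp.
(* Integrable because [D <= 2 (p + p')]. *)
have iD : mu0.-integrable setT (EFin \o D).
  apply: (le_integrable measurableT _ _
    (integrableZl measurableT 2 (integrableD measurableT ip ip'))).
    exact/measurable_EFinP.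
  move=> x _ /=; rewrite lee_fin.
  rewrite !ger0_norm ?sqr_ge0 ?mulr_ge0 ?addr_ge0//.
  have := sqr_sqrtr (p0 x); have := sqr_sqrtr (p'0 x); rewrite /D.
  have := sqr_ge0 (Num.sqrt (p x) + Num.sqrt (p' x)).
  nra.
have zab : z0 <= a * b.
  rewrite -(ler_pXn2r (n := 2))// ?nnegrE ?mulr_ge0 ?(ltW a0) ?(ltW b0) ?(ltW z00)//.
  by rewrite exprMn aE bE expr2 ler_pM// ltW.
apply: (@le_trans _ _ ((a * b)^-1 * \int[mu0]_x D x)); last first.
  rewrite ler_wpM2r//; last by rewrite lef_pV2 ?posrE ?mulr_gt0.
  by apply: Rintegral_ge0 => x _; exact: sqr_ge0.
(* The mixed product of roots is expressed through [D], so that the other two terms are multiples of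
   [p] and [p'], with known integrals [Z] and [Z']. *)
have sqE x : (Num.sqrt (p x / Z) - Num.sqrt (p' x / Z')) ^+ 2 =
   (a * b)^-1 * D x + ((a ^- 2 - (a * b)^-1) * p x + (b ^- 2 - (a * b)^-1) * p' x).
  rewrite /D !sqrtrM// !sqrtrV ?(ltW Z0) ?(ltW Z'0)// -/a -/b.
  have := sqr_sqrtr (p0 x); have := sqr_sqrtr (p'0 x).
  set c := Num.sqrt (p x); set c' := Num.sqrt (p' x) => <- <-.
  by field; rewrite !lt0r_neq0.
have -> : \int[mu0]_x (Num.sqrt (p x / Z) - Num.sqrt (p' x / Z')) ^+ 2 =
   (a * b)^-1 * \int[mu0]_x D x + ((a ^- 2 - (a * b)^-1) * Z + (b ^- 2 - (a * b)^-1) * Z').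
  have i1 := integrableZl measurableT ((a * b)^-1) iD.
  have i2 := integrableZl measurableT (a ^- 2 - (a * b)^-1) ip.
  have i3 := integrableZl measurableT (b ^- 2 - (a * b)^-1) ip'.
  under eq_Rintegral do rewrite sqE.
  rewrite RintegralD//; last exact: (integrableD measurableT i2 i3).
  rewrite RintegralD// !RintegralZl//.
rewrite gerDl -aE -bE.
(* The remainder is [2 - a/b - b/a], which is never positive. *)
rewrite (_ : _ + _ = - ((a - b) ^+ 2 / (a * b))).
  by rewrite oppr_le0 divr_ge0 ?sqr_ge0// mulr_ge0// ltW.
by field; rewrite !lt0r_neq0.
Qed.

(** * Lipschitz dependence of the posterior *)

(** For [a <= b], factoring out [expR (- a / 2)] leaves [1 - expR (- (b - a) / 2) <= (b - a) / 2];
    squaring produces the factor [1/4]. *)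
Lemma sqr_sqrt_expRN_sub (R : realType) (a b m : R) : m <= a -> m <= b ->
  (Num.sqrt (expR (- a)) - Num.sqrt (expR (- b))) ^+ 2 <= 4^-1 * expR (- m) * (a - b) ^+ 2.
Proof.
have sqrtE (x : R) : Num.sqrt (expR (- x)) = expR (- (x / 2)).
  rewrite (_ : - x = - (x / 2) + - (x / 2)); last by lra.
  by rewrite expRD -expr2 sqrtr_sqr ger0_norm ?expR_ge0.
wlog ab : a b / a <= b => [hw ma mb|].
  have [ab|/ltW ba] := leP a b; first exact: hw.
  by rewrite -sqrrN opprB -[X in _ <= _ * X]sqrrN opprB hw.
move=> ma mb; rewrite !sqrtE.
have h0 : expR (- (b / 2)) <= expR (- (a / 2)) by rewrite ler_expR; lra.
have h1 : expR (- (a / 2)) - expR (- (b / 2)) <= expR (- (a / 2)) * ((b - a) / 2).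
  rewrite (_ : - (b / 2) = - (a / 2) + - ((b - a) / 2)); last by lra.
  rewrite expRD -{1}[expR (- (a / 2))]mulr1 -mulrBr ler_pM2l ?expR_gt0//.
  by have := expR_ge1Dx (- ((b - a) / 2)); lra.
apply: (@le_trans _ _ ((expR (- (a / 2)) * ((b - a) / 2)) ^+ 2)).
  by rewrite ler_sqr ?nnegrE ?subr_ge0// mulr_ge0 ?expR_ge0//; lra.
have -> : (expR (- (a / 2)) * ((b - a) / 2)) ^+ 2 = 4^-1 * expR (- a) * (a - b) ^+ 2.
  rewrite (_ : - a = - (a / 2) + - (a / 2)); last by lra.
  by rewrite expRD; field.
by rewrite ler_wpM2r ?sqr_ge0// ler_wpM2l// ler_expR lerN2.
Qed.

Lemma locally_lipschitz_continuous (R : realType) (X : normedModType R) (f : X -> R) :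
  (forall r : R, exists L : R, forall u1 u2 : X,
     `|u1| < r -> `|u2| < r -> `|f u1 - f u2| <= L * `|u1 - u2|) ->
  continuous f.
Proof.
move=> lip u; have [L hL] := lip (`|u| + 1).
(* [L] may be zero or negative, and the radius [e / L'] asks for a positive constant. *)
pose L' := Num.max L 1.
have L'0 : 0 < L' by rewrite lt_max ltr01 orbT.
apply/cvgrPdist_le => e e0.
have eL : 0 < e / L' by rewrite divr_gt0.
near=> v.
have v1 : `|u - v| < 1 by near: v; exact: cvgr_dist_lt.
have v2 : `|u - v| <= e / L' by near: v; exact: cvgr_dist_le.
apply: le_trans (hL u v _ _) _.
- by rewrite ltrDl.
- rewrite -[v](subKr u) (le_lt_trans (ler_normB _ _))// ltrD2l//.
- apply: (@le_trans _ _ (L' * `|u - v|)).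
    by rewrite ler_wpM2r// le_max lexx.
  by rewrite mulrC -ler_pdivlMr.
Unshelve. all: by end_near. Qed.

(** Countably many balls exhaust the space and cannot all be null. On such a ball [Phi] is bounded
    above, which keeps the normalizing constants away from 0. *)
Lemma exists_ball_gt0 (R : realType) (X : normedModType R)
  (mu0 : probability (borel X) R) :
  exists2 n : nat, measurable [set u : borel X | `|u : X| < n%:R] &
   (0 < mu0 [set u : borel X | (`|u : X| < n%:R)%R])%E.
Proof.
pose B (n : nat) : set (borel X) := [set u : borel X | `|u : X| < n%:R].
have mB n : measurable (B n).
  pose nrm (u : borel X) : R := `|u : X|.
  have -> : B n = nrm @^-1` [set` `]-oo, (n%:R : R)[%R].
    by apply/seteqP; split => u; rewrite /B /= in_itv.
  rewrite -[X in measurable X]setTI.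
  apply: (continuous_measurable_borel _ _ (fun u : X => `|u|)) => //.
  exact: norm_continuous.
apply: contrapT => h.
have B0 n : mu0 (B n) = 0%E.
  apply/eqP; case: eqP => // /eqP Bn; exfalso; apply: h.
  by exists n; [exact: mB|rewrite lt0e Bn measure_ge0].
have : mu0.-negligible (\bigcup_n B n).
  apply: (@negligible_bigcup _ _ _ mu0) => n.
  by exists (B n); split; [exact: mB|exact: B0|].
rewrite (_ : \bigcup_n B n = setT).
  move=> /(measure_negligible measurableT) /= T0.
  have := @probability_setT _ _ _ mu0; rewrite [LHS]T0 => /esym/eqP.
  by rewrite onee_eq0.
apply/seteqP; split => // u _.
have [n _ /(_ n (leqnn n)) un] := nbhs_infty_gtr `|u : X|.
by exists n.
Qed.

Lemma posterior_hellinger_lipschitz (R : realType) (X Y : normedModType R)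
  (Phi : X -> Y -> R) (alpha1 alpha2 r M C' : R) (mu0 : probability (borel X) R)
  (post : borel Y -> probability (borel X) R) :
  0 < alpha1 -> 0 < alpha2 ->
  (forall u y, `|y| < r -> M - alpha1 * `|u| <= Phi u y) ->
  (forall r' : R, 0 < r' -> exists2 K : R, 0 < K & forall (u : X) (y : Y),
     Num.max `|u| `|y| < r' -> Phi u y <= K) ->
  (forall y, continuous (fun u => Phi u y)) ->
  (forall (y1 y2 : Y) (u : X), Num.max `|y1| `|y2| < r ->
     `|Phi u y1 - Phi u y2| <= expR (alpha2 * `|u| + C') * `|y1 - y2|) ->
  (\int[mu0]_u (expR ((alpha1 + 2 * alpha2) * `|u : X|))%:E < +oo)%E ->
  (forall y, has_density (post y) mu0
    (fun u => expR (- Phi u y) / \int[mu0]_v expR (- Phi v y))) ->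
  exists C : R, forall y y' : Y, Num.max `|y| `|y'| < r ->
    forall nu : {sigma_finite_measure set (borel X) -> \bar R},
      post y `<< nu ->
      hellinger nu (post y) (post y') <= C * `|y - y'|.
Proof.
move=> al1 al2 lower upper cont lip moment dens.
pose al := alpha1 + 2 * alpha2.
pose e (u : borel X) := expR (al * `|u : X|).
have mnorm : measurable_fun setT (fun u : borel X => `|u : X| : R).
  by apply: continuous_measurable_borel; exact: norm_continuous.
have me : measurable_fun setT e.
  by apply: measurableT_comp => //; exact: measurable_funM.
have ie : mu0.-integrable setT (EFin \o e).
  apply/integrableP; split; first exact/measurable_EFinP.
  under eq_integral do rewrite /= ger0_norm ?expR_ge0//.
  exact: moment.
pose p (y : Y) (u : borel X) := expR (- Phi u y).
have mp y : measurable_fun setT (p y).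
  apply: measurableT_comp => //; apply: measurableT_comp => //.
  exact: (continuous_measurable_borel _ _ (fun u => Phi u y)).
have p0 y u : 0 <= p y u by exact: expR_ge0.
have ip y : `|y| < r -> mu0.-integrable setT (EFin \o p y).
  move=> yr; apply: (le_integrable measurableT _ _ (integrableZl measurableT (expR (- M)) ie)).
    exact/measurable_EFinP.
  move=> u _ /=; rewrite lee_fin !ger0_norm ?mulr_ge0 ?expR_ge0//.
  rewrite -expRD ler_expR /al mulrDl.
  have := lower u y yr; have : 0 <= 2 * alpha2 * `|u : X| by rewrite !mulr_ge0// ltW.
  by lra.
have [n mB Bn] := exists_ball_gt0 _ _ mu0.
set B := [set u : borel X | _] in mB Bn.
(* This radius is positive and exceeds both [n] and [r], whatever the sign of [r]. *)
have [K _ hK] : exists2 K : R, 0 < K & forall (u : X) (y : Y),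
     Num.max `|u| `|y| < Num.max n%:R 0 + Num.max r 0 + 1 -> Phi u y <= K.
  by apply: upper; rewrite ltr_wpDl// addr_ge0// le_max lexx orbT.
pose z0 := expR (- K) * fine (mu0 B).
have Bfin : mu0 B \is a fin_num by exact: fin_num_measure.
have z00 : 0 < z0 by rewrite mulr_gt0 ?expR_gt0// -lte_fin fineK.
have Zge y : `|y| < r -> z0 <= \int[mu0]_u p y u.
  move=> yr; rewrite -lee_fin /z0 EFinM !fineK//; last first.
    exact: integrable_fin_num (ip y yr).
  rewrite -integral_cst//.
  apply: (@le_trans _ _ (\int[mu0]_(u in B) (p y u)%:E)%E).
    apply: ge0_le_integral => //.
    - by move=> u _; rewrite /= lee_fin expR_ge0.
    - by apply/measurable_EFinP; exact: measurable_funTS.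
    - move=> u Bu; rewrite lee_fin ler_expR lerN2; apply: hK.
      have un : `|u : X| < n%:R := Bu.
      have n1 : n%:R <= Num.max n%:R 0 :> R by rewrite le_max lexx.
      have r1 : r <= Num.max r 0 :> R by rewrite le_max lexx.
      have n2 : 0 <= Num.max n%:R 0 :> R by rewrite le_max lexx orbT.
      have r2 : 0 <= Num.max r 0 :> R by rewrite le_max lexx orbT.
      by rewrite gt_max; apply/andP; split; lra.
  apply: ge0_subset_integral => //.
  - by apply/measurable_EFinP.
  - by move=> u _; rewrite lee_fin.
(* [4^-1 * expR (- M)] comes from [sqr_sqrt_expRN_sub] with the lower bound [M - alpha1 |u|], and
   [expR (2 * C')] from squaring the Lipschitz bound in [y]. *)
pose c := 4^-1 * expR (- M) * expR (2 * C').
pose E := \int[mu0]_u e u.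
have E0 : 0 <= E by apply: Rintegral_ge0 => u _; exact: expR_ge0.
have c0 : 0 <= c by rewrite !mulr_ge0 ?expR_ge0.
exists (Num.sqrt (2^-1 * (z0^-1 * (c * E)))) => y y' yy' nu ynu.
have [yr y'r] : `|y| < r /\ `|y'| < r by move: yy'; rewrite gt_max => /andP[].
have Z0 := lt_le_trans z00 (Zge y yr).
have Z'0 := lt_le_trans z00 (Zge y' y'r).
have mdens y0 : measurable_fun setT
    (fun u : borel X => expR (- Phi u y0) / \int[mu0]_v expR (- Phi v y0)).
  by apply: measurable_funM => //; exact: mp.
(* The posterior density is positive everywhere, so [mu0] is dominated by [post y] and hence by
   [nu]. *)
have munu : mu0 `<< nu.
  apply: null_dominates_trans ynu.
  apply: (has_density_dominates _ _ _ _ _ _ (mdens y) _ (dens y)) => u.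
  by rewrite divr_gt0// expR_gt0.
rewrite (hellinger_has_density _ _ _ _ _ _ _ _ _ (mdens y) (mdens y') _ _
  (dens y) (dens y') munu); last 2 first.
- by move=> u; rewrite divr_ge0 ?expR_ge0// ltW.
- by move=> u; rewrite divr_ge0 ?expR_ge0// ltW.
have -> : Num.sqrt (2^-1 * (z0^-1 * (c * E))) * `|y - y'| =
   Num.sqrt (2^-1 * (z0^-1 * (c * `|y - y'| ^+ 2 * E))).
  rewrite (_ : 2^-1 * (z0^-1 * (c * `|y - y'| ^+ 2 * E)) =
    (2^-1 * (z0^-1 * (c * E))) * `|y - y'| ^+ 2); last by ring.
  rewrite [RHS]sqrtrM; last by rewrite !mulr_ge0// invr_ge0 ltW.
  by rewrite sqrtr_sqr normr_id.
rewrite ler_wsqrtr// ler_wpM2l//.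
apply: le_trans (Rintegral_normalized_sqrt_dist _ _ _ _ _ _ z0 (mp y) (mp y') (p0 y) (p0 y')
   (ip y yr) (ip y' y'r) z00 (Zge y yr) (Zge y' y'r)) _.
rewrite ler_wpM2l ?invr_ge0 ?(ltW z00)//.
have bound u : (Num.sqrt (p y u) - Num.sqrt (p y' u)) ^+ 2 <= c * `|y - y'| ^+ 2 * e u.
  apply: (le_trans (sqr_sqrt_expRN_sub _ _ _ (M - alpha1 * `|u : X|)
    (lower u y yr) (lower u y' y'r))).
  have l2 : (Phi u y - Phi u y') ^+ 2 <= (expR (alpha2 * `|u : X| + C') * `|y - y'|) ^+ 2.
    by rewrite -real_normK ?num_real// ler_sqr ?nnegrE ?mulr_ge0 ?expR_ge0// lip.
  apply: (le_trans (ler_wpM2l _ l2)); first by rewrite mulr_ge0 ?expR_ge0.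
  have -> : (expR (alpha2 * `|u : X| + C') * `|y - y'|) ^+ 2 =
      expR (2 * C') * expR (2 * alpha2 * `|u : X|) * `|y - y'| ^+ 2.
    by rewrite exprMn expr2 -!expRD; congr (expR _ * _); ring.
  have -> : expR (- (M - alpha1 * `|u : X|)) = expR (- M) * expR (alpha1 * `|u : X|).
    by rewrite -expRD; congr expR; ring.
  have -> : e u = expR (alpha1 * `|u : X|) * expR (2 * alpha2 * `|u : X|).
    by rewrite -expRD; congr expR; rewrite /al; ring.
  by rewrite le_eqVlt; apply/orP; left; apply/eqP; rewrite /c; ring.
rewrite /E -RintegralZl//; apply: le_Rintegral => //.
- apply: (le_integrable measurableT _ _ (integrableZl measurableT (c * `|y - y'| ^+ 2) ie)).
  + apply/measurable_EFinP; apply: measurable_funX.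
    have msqrt : measurable_fun setT (@Num.sqrt R).
      by apply: continuous_measurable_fun; exact: sqrt_continuous.
    by apply: measurable_funB; apply: (measurableT_comp msqrt).
  + move=> u _ /=; rewrite lee_fin ger0_norm ?sqr_ge0//.
    exact: le_trans (bound u) (ler_norm _).
- exact: (integrableZl measurableT (c * `|y - y'| ^+ 2) ie).
Qed.

Theorem theorem3p3 (R : realType) (d : nat) (X Y : completeNormedModType R)
  (Q0 : probability (borel Y) R) (G : X -> Y)
  (Q : X -> probability (borel Y) R) (Phi : X -> Y -> R)
  (alpha1 alpha2 : R)
  (rho : nat) (psi : nat -> 'rV[R]_d -> R)
  (t : R) (iota : (@test_function R d -> R) -> X) (ce : R)
  (s q r1 kappa : R) (mu0 : probability (borel X) R)
  (post : borel Y -> probability (borel X) R) :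
  (0 < d <= 3)%N ->
  (forall (u : X) (B : set (borel Y)), measurable B ->
     Q u B = Q0 [set eta : borel Y | B (G u + (eta : Y))]) ->
  (forall u : X, has_density (Q u) Q0 (fun y => expR (- Phi u y))) ->
  (forall u : X, (\int[Q0]_y (expR (- Phi u y))%:E = 1)%E) ->
  0 < alpha1 ->
  (forall r : R, 0 < r -> exists M : R, forall (u : X) (y : Y),
     `|y| < r -> M - alpha1 * `|u| <= Phi u y) ->
  (forall r : R, 0 < r -> exists2 K : R, 0 < K & forall (u : X) (y : Y),
     Num.max `|u| `|y| < r -> Phi u y <= K) ->
  (forall r : R, 0 < r -> exists2 L : R, 0 < L & forall (u1 u2 : X) (y : Y),
     Num.max (Num.max `|u1| `|u2|) `|y| < r ->
     `|Phi u1 y - Phi u2 y| <= L * `|u1 - u2|) ->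
  0 < alpha2 ->
  (forall r : R, 0 < r -> exists C' : R, forall (y1 y2 : Y) (u : X),
     Num.max `|y1| `|y2| < r ->
     `|Phi u y1 - Phi u y2| <= expR (alpha2 * `|u| + C') * `|y1 - y2|) ->
  wavelet_basis rho psi -> s < rho%:R ->
  holder_embedding psi t iota ce ->
  1 <= q -> t + d%:R / q < s ->
  admissible_r1 d s t q r1 ->
  0 < kappa -> 2 * ce * r_star d q r1 * (alpha1 + 2 * alpha2) < kappa ->
  besov_measure psi iota kappa s q mu0 ->
  posterior mu0 Q Phi post ->
  forall r : R, 0 < r -> exists C : R, forall y y' : Y,
    Num.max `|y| `|y'| <= r ->
    forall nu : {sigma_finite_measure set (borel X) -> \bar R},
      post y `<< nu -> post y' `<< nu ->
      hellinger nu (post y) (post y') <= C * `|y - y'|.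
Proof.
move=> d3 _ _ _ al1 lower upper lipu al2 lipy _ _ emb q1 ts _ k0 kk prior [_ dens] r r0.
have /andP[d0 _] := d3.
have al0 : 0 < alpha1 + 2 * alpha2 by rewrite addr_gt0// mulr_gt0.
(* The claim concerns norms at most [r], the hypotheses norms strictly below a radius; [r + 1]
   bridges the two. *)
have r10 : 0 < r + 1 by rewrite addr_gt0.
have moment : (\int[mu0]_u (expR ((alpha1 + 2 * alpha2) * `|u : X|))%:E < +oo)%E.
  apply: (besov_measure_exp_moment _ _ _ _ _ _ _ _ _ _ _ _ d0 emb q1 ts k0 al0 _ prior) => qE.
  (* With [r_star >= 1] the condition on [kappa] implies [2 ce (alpha1 + 2 alpha2) < kappa]; when
     [ce <= 0] the left-hand side with [Num.max ce 0] vanishes. *)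
  have rs1 : 1 <= r_star d q r1 by rewrite qE; exact: r_star_ge1.
  have [ce0|ce0] := leP ce 0; first by rewrite mulr0 mul0r.
  apply: (le_lt_trans _ kk); rewrite ler_wpM2r ?(ltW al0)//.
  by rewrite ler_peMr// mulr_ge0// ltW.
have cont y : continuous (fun u => Phi u y).
  apply: locally_lipschitz_continuous => rho0.
  (* One radius for both arguments: it is enlarged beyond the norm of the fixed [y]. *)
  pose k := Num.max rho0 (`|y| + 1).
  have yk : `|y| < k by rewrite lt_max ltrDl ltr01 orbT.
  have [L _ hL] := lipu k (le_lt_trans (normr_ge0 y) yk).
  exists L => u1 u2 u1r u2r; apply: hL.
  by rewrite !gt_max yk andbT; apply/andP; split; rewrite lt_max ?u1r ?u2r.
have [M hM] := lower _ r10.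
have [C' hC'] := lipy _ r10.
have [C hC] := posterior_hellinger_lipschitz _ _ _ _ _ _ _ _ _ _ _ al1 al2
  (fun u y => hM u y) upper cont hC' moment dens.
exists C => y y' yy' nu ynu _; apply: hC => //.
by rewrite (le_lt_trans yy')// ltrDl.
Qed.
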